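(* Let $p$ be a positive integer or $p=\infty$. Let $\widehat{\lambda}_j\in\mathbb{C}$, let $n_{k_1^{(j)}},\dots,n_{k_{s_j}^{(j)}}$ be positive integers with $\sum_{\ell=1}^{s_j}n_{k_\ell^{(j)}}=p_j$, let $M_j:=\mathrm{diag}(N_{k_1^{(j)}},\dots,N_{k_{s_j}^{(j)}})\in\mathbb{R}_+^{p_j\times p_j}$, let $Q_j\in\mathbb{C}^{p_j\times p_j}$, and let $R_j\in\mathbb{R}_+^{p_j\times p_j}$. Suppose $\mathrm{Re}(\widehat{\lambda}_j)-\|M_j+R_j\|_p>0$ and $|Q_j|\le R_j$, and define $$\delta_p:=\|R_j\|_p\Bigl(\Gamma^{(1)}\bigl(\mathrm{Re}(\widehat{\lambda}_j)+\|M_j+R_j\|_p\bigr)+\omega\bigl(\mathrm{Re}(\widehat{\lambda}_j)+\|M_j+R_j\|_p\bigr)+\omega\bigl(\mathrm{Re}(\widehat{\lambda}_j)-\|M_j+R_j\|_p\bigr)\Bigr).$$ Then $\|\Gamma(\widehat{\lambda}_jI_{p_j}+M_j+Q_j)-\Gamma(\widehat{\lambda}_jI_{p_j}+M_j)\|_p<\delta_p$.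
   Context: For each index $k$, $N_k\in\mathbb{R}^{n_k\times n_k}$ is the matrix with ones on the first superdiagonal and zeros elsewhere (so $N_k=0$ when $n_k=1$), and $\mathrm{diag}(\cdot)$ denotes a block diagonal matrix. $\mathbb{R}_+^{m\times m}$ is the set of real $m\times m$ matrices with all entries nonnegative. $\|\cdot\|_p$ is the operator norm on matrices induced by the vector $p$-norm. $|Q_j|$ is the entrywise modulus, and inequalities between real matrices are entrywise. $I_m$ is the $m\times m$ identity matrix. For real $\alpha>0$, $\omega(\alpha):=\dfrac{2\alpha+1}{\alpha^2(\alpha+1)^2}+\dfrac{\cosh(1)-1}{(\alpha+2)^2}$. $\Gamma^{(1)}$ is the first derivative of the scalar gamma function. For a square complex matrix $B$ with no eigenvalue in $\{z\in\mathbb{Z}:z\le 0\}$, $\Gamma(B)$ is the matrix gamma function, i.e. the primary matrix function associated with the scalar function $\Gamma$; when all eigenvalues of $B\in\mathbb{C}^{m\times m}$ have positive real part, $\Gamma(B)=\int_0^\infty e^{-t}t^{B-I_m}\,dt$ with $t^{B-I_m}:=e^{(B-I_m)\log t}$.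
   Formalization: The formal theorem additionally assumes R_j ≠ 0; when R_j = 0 one has Q_j = 0 and δ_p = 0, so the strict inequality would read 0 < 0 and is false. *)

(* Defs.v *)
From HB Require Import structures.
From mathcomp Require Import all_boot all_order all_algebra.
From mathcomp Require Import complex.
From mathcomp Require Import all_classical all_reals all_analysis.

Set Implicit Arguments.
Unset Strict Implicit.
Unset Printing Implicit Defensive.

Import Order.TTheory GRing.Theory Num.Theory.
Import numFieldNormedType.Exports.

Local Open Scope complex_scope.
Local Open Scope ring_scope.
Local Open Scope classical_set_scope.

(* The exponent ranges over the positive integers and oo; oo is None. *)
Definition exponent := option nat.

Definition valid_exponent (p : exponent) : bool :=
  if p is Some q then (0 < q)%N else true.

Definition vnorm (R : realType) (p : exponent) (m : nat) (v : 'cV[R[i]]_m) : R :=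
  if p is Some q
  then (\sum_(i < m) Normc.normc (v i 0) ^+ q) `^ (q%:R^-1)
  else \big[Num.max/0]_(i < m) Normc.normc (v i 0).

(* For m = 0 this is sup set0 = 0. *)
Definition opnorm (R : realType) (p : exponent) (m : nat) (A : 'M[R[i]]_m) : R :=
  sup [set vnorm p (A *m v) / vnorm p v | v in [set v | v != 0]].

Definition cplx_mx (R : realType) (m n : nat) (A : 'M[R]_(m, n)) :
    'M[R[i]]_(m, n) :=
  map_mx (fun x : R => x%:C) A.

Definition superdiag (R : realType) (m : nat) : 'M[R]_m :=
  \matrix_(i < m, j < m) (i.+1 == j :> nat)%:R.

Definition cexp (R : realType) (z : R[i]) : R[i] :=
  (expR (complex.Re z))%:C * (cos (complex.Im z) +i* sin (complex.Im z)).

Definition gamma_integrand (R : realType) (z : R[i]) (t : R) : R[i] :=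
  (expR (- t))%:C * cexp ((z - 1) * (ln t)%:C).

Definition euler_gamma (R : realType) (z : R[i]) : R[i] :=
  Rintegral lebesgue_measure `]0, +oo[ (fun t : R => complex.Re (gamma_integrand z t))
  +i* Rintegral lebesgue_measure `]0, +oo[ (fun t : R => complex.Im (gamma_integrand z t)).

(* Euler's integral on the right half-plane, continued to the left by
   Gamma(z) = Gamma(z + n) / (z (z + 1) ... (z + n - 1)); at the poles
   0, -1, -2, ... the value is 0. *)
Definition Gamma (R : realType) (z : R[i]) : R[i] :=
  if 0 < complex.Re z then euler_gamma z
  else let n := (Num.truncn (- complex.Re z)).+1 in
       euler_gamma (z + n%:R) / \prod_(k < n) (z + k%:R).

Definition Gamma_derive (R : realType) (k : nat) : R[i] -> R[i] :=
  derive1n k (@Gamma R : R[i]^o -> R[i]^o).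

(* Real for real x. *)
Definition Gamma1 (R : realType) (x : R) : R :=
  complex.Re (Gamma_derive 1 x%:C).

Definition hermite_interpolates (R : realType) (n : nat)
    (f : R[i]^o -> R[i]^o) (A : 'M[R[i]]_n.+1) (r : {poly R[i]}) : Prop :=
  forall (a : R[i]) (k : nat), (k < mup a (mxminpoly A))%N ->
    (r^`(k)).[a] = derive1n k f a.

(* The primary matrix function f(A) is r(A) for any polynomial r which agrees
   on the spectrum of A with f, i.e. at each eigenvalue a up to the derivative
   of order (multiplicity of a in the minimal polynomial of A) - 1. *)
Definition primary_mx (R : realType) (f : R[i]^o -> R[i]^o) (n : nat) :
    'M[R[i]]_n -> 'M[R[i]]_n :=
  if n is n'.+1 return 'M[R[i]]_n -> 'M[R[i]]_n
  then fun A => horner_mx A (xget 0 [set r | hermite_interpolates f A r])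
  else id.

Definition Gamma_mx (R : realType) (n : nat) (A : 'M[R[i]]_n) : 'M[R[i]]_n :=
  primary_mx (@Gamma R) A.

Definition cosh (R : realType) (x : R) : R := (expR x + expR (- x)) / 2.

Definition omega (R : realType) (a : R) : R :=
  (2 * a + 1) / (a ^+ 2 * (a + 1) ^+ 2) + (cosh 1 - 1) / (a + 2) ^+ 2.

Definition delta (R : realType) (p : exponent) (m : nat) (lam : R[i])
    (M Rj : 'M[R]_m) : R :=
  let mu := opnorm p (cplx_mx (M + Rj)) in
  let x := complex.Re lam in
  opnorm p (cplx_mx Rj) *
    (Gamma1 (x + mu) + omega (x + mu) + omega (x - mu)).

(* Main.v *)
Require Import Defs.
From mathcomp Require Import all_boot all_order all_algebra.
From mathcomp Require Import complex.
From mathcomp Require Import all_classical all_reals all_analysis.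
From mathcomp Require Import measurable_realfun ring lra.

Set Implicit Arguments.
Unset Strict Implicit.
Unset Printing Implicit Defensive.

Import Order.TTheory GRing.Theory Num.Theory.
Import numFieldNormedType.Exports.
Local Open Scope complex_scope.
Local Open Scope ring_scope.

(** Write [A = lam + X] for either of the two matrices, so that [X] is [M + Q] or
    [M], and put [mu = |M + Rj|] (operator norm) and [x = Re lam > mu]. Entrywise
    domination gives [|X| <= mu]. On the disc [|z - lam| < x] the Gamma function
    is the sum of its Taylor series at [lam], with coefficients
<<
      c_j = 1/j! * integral over (0, oo) of exp(-t) t^(lam-1) (ln t)^j dt
>>
    and the eigenvalues of [A] lie in the disc [|z - lam| <= mu]. Hence
    [Gamma(lam + X)] is the sum of the series [c_j X^j] ([Gamma_mx_taylor]), and by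
    the telescoping bound [|X^j - Y^j| <= j mu^(j-1) |X - Y|] the difference of the
    two values is at most
<<
      |Rj| * sum_j j |c_j| mu^(j-1)
        <= |Rj| * integral of exp(-t) t^(x-1) |ln t| exp(mu |ln t|) dt
>>
    ([Gamma_mx_perturbation]). Splitting the last integral at [t = 1] turns it into
<<
      Gamma'(x+mu) + I(x+mu) + I(x-mu),
      I(c) = integral over (0, 1) of exp(-t) t^(c-1) (- ln t) dt,
>>
    and [exp(-t) <= 1 - t + t^2/2] gives
    [I(c) <= 1/c^2 - 1/(c+1)^2 + 1/(2 (c+2)^2) < omega c], the last inequality being
    strict because [cosh 1 - 1 > 1/2] ([eint_logneg_lt], [eint_ewt1_lt]).

    Analytically everything is expressed with [eint h], the integral of
    [exp(-t) h(ln t)] over the half-line. Its integrands are powers of [s = ln t]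
    times complex exponentials of [s], and a single remainder estimate for the
    exponential series ([cexp_rem_le]) yields both the complex derivatives of Gamma
    ([derive1n_Gamma]) and the geometric convergence of all formal derivatives of
    the Taylor series ([gmoment_taylor]). The passage from scalars to matrices uses
    Newton's form of Hermite interpolation ([hermite_newton]): modulo the minimal
    polynomial of [A], a polynomial is a fixed combination of its jets at the
    eigenvalues, so convergence of the jets implies convergence of the matrices. *)

(** * The modulus, the p-norm and its operator norm *)

Section Modulus.
Context {R : realType}.
Implicit Types x y z : R[i].

Lemma normc_norm z : `|z| = (Normc.normc z)%:C.
Proof. by case: z. Qed.

Lemma normc_ge0 z : 0 <= Normc.normc z.
Proof. by case: z => a b; rewrite sqrtr_ge0. Qed.

Lemma normcD x y :
  Normc.normc (x + y) <= Normc.normc x + Normc.normc y.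
Proof. exact: le_normcD. Qed.

Lemma normc_opp z : Normc.normc (- z) = Normc.normc z.
Proof. exact: normcN. Qed.

Lemma normc_eq0 z : (Normc.normc z == 0) = (z == 0).
Proof.
apply/eqP/eqP => [|->]; first exact: Normc.eq0_normc.
exact: Normc.normc0.
Qed.

Lemma normc_real (a : R) : Normc.normc a%:C = `|a|.
Proof. by rewrite /= expr0n /= addr0 sqrtr_sqr. Qed.

Lemma normc_sum (I : Type) (r : seq I) (P : pred I) (F : I -> R[i]) :
  Normc.normc (\sum_(i <- r | P i) F i) <= \sum_(i <- r | P i) Normc.normc (F i).
Proof.
elim/big_rec2: _ => [|i a z _ le_za]; first by rewrite Normc.normc0.
by rewrite (le_trans (normcD _ _))// lerD2l.
Qed.

Lemma ler_Re_normc z : `|complex.Re z| <= Normc.normc z.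
Proof.
by case: z => a b /=; rewrite -sqrtr_sqr ler_wsqrtr// lerDl sqr_ge0.
Qed.

Lemma ler_Im_normc z : `|complex.Im z| <= Normc.normc z.
Proof.
by case: z => a b /=; rewrite -sqrtr_sqr ler_wsqrtr// lerDr sqr_ge0.
Qed.

End Modulus.

Section VectorNorm.
Context {R : realType}.

Lemma convex_exprn (q : nat) (s t a b : R) :
  0 <= s -> 0 <= t -> s + t = 1 -> 0 <= a -> 0 <= b -> (0 < q)%N ->
  (s * a + t * b) ^+ q <= s * a ^+ q + t * b ^+ q.
Proof.
move=> s0 t0 st a0 b0; elim: q => // -[|q] IH _; first by rewrite !expr1.
rewrite exprS.
apply: (@le_trans _ _ ((s * a + t * b) * (s * a ^+ q.+1 + t * b ^+ q.+1))).
  by rewrite ler_wpM2l ?IH// addr_ge0// mulr_ge0.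
rewrite [in leRHS]exprS [b ^+ q.+2]exprS.
move: (a ^+ q.+1) (b ^+ q.+1) (ler_pXn2r (ltn0Sn q) a0 b0)
  (ler_pXn2r (ltn0Sn q) b0 a0) => A B.
have -> : t = 1 - s by rewrite -st addrC addKr.
move=> AB BA; rewrite -subr_ge0.
have -> : s * (a * A) + (1 - s) * (b * B) -
    (s * a + (1 - s) * b) * (s * A + (1 - s) * B)
  = s * (1 - s) * ((a - b) * (A - B)) by ring.
have -> : 1 - s = t by rewrite -st addrC addKr.
apply: mulr_ge0; first exact: mulr_ge0.
case: (leP a b) => ab.
  by apply: mulr_le0; rewrite subr_le0 ?AB.
by apply: mulr_ge0; rewrite subr_ge0 ?BA ltW.
Qed.

Variables (p : exponent) (m : nat).
Implicit Types u v : 'cV[R[i]]_m.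

Lemma vnorm_ge0 v : 0 <= vnorm p v.
Proof.
case: p => [q|] /=; first exact: powR_ge0.
exact: bigmax_ge_id.
Qed.

Lemma vnorm_expr q v : (0 < q)%N ->
  vnorm (Some q) v ^+ q = \sum_(i < m) Normc.normc (v i 0) ^+ q.
Proof.
move=> q0; rewrite /= -powR_mulrn ?powR_ge0// -powRrM mulVf ?powRr1//.
  by apply: sumr_ge0 => i _; rewrite exprn_ge0// normc_ge0.
by rewrite pnatr_eq0 -lt0n.
Qed.

Lemma vnorm_le_expr q v (c : R) : (0 < q)%N -> 0 <= c ->
  \sum_(i < m) Normc.normc (v i 0) ^+ q <= c ^+ q -> vnorm (Some q) v <= c.
Proof.
move=> q0 c0; rewrite -vnorm_expr// ler_pXn2r// nnegrE//.
exact: (@powR_ge0 R).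
Qed.

Lemma vnorm_oo_le v (c : R) : 0 <= c ->
  (forall i, Normc.normc (v i 0) <= c) -> vnorm None v <= c.
Proof.
by move=> c0 vc; exact: bigmax_le.
Qed.

Lemma vnorm_oo_ge v i : Normc.normc (v i 0) <= vnorm None v.
Proof. by rewrite /= (bigD1 i)//= le_max lexx. Qed.

Hypothesis p_ok : valid_exponent p.

(** The p-norm dominates the modulus of each coordinate. *)
Lemma vnorm_coord v i : Normc.normc (v i 0) <= vnorm p v.
Proof.
case: p p_ok => [q /= q0|_]; last exact: vnorm_oo_ge.
rewrite -(@ler_pXn2r _ q)// ?nnegrE ?normc_ge0 ?(@powR_ge0 R)//.
rewrite -[X in _ <= X ^+ _]/(vnorm (Some q) v) vnorm_expr//.
rewrite (bigD1 i)//= lerDl sumr_ge0// => j _.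
by rewrite exprn_ge0// normc_ge0.
Qed.

Lemma vnorm_mono u v :
  (forall i, Normc.normc (u i 0) <= Normc.normc (v i 0)) ->
  vnorm p u <= vnorm p v.
Proof.
case: p p_ok => [q q0|_] uv.
  apply: vnorm_le_expr => //; first exact: (@powR_ge0 R).
  rewrite vnorm_expr//; apply: ler_sum => i _.
  by apply: lerXn2r; rewrite ?nnegrE ?normc_ge0.
apply: vnorm_oo_le => [|i]; last by rewrite (le_trans (uv i))// vnorm_oo_ge.
exact: bigmax_ge_id.
Qed.

Lemma vnorm_gt0 v : v != 0 -> 0 < vnorm p v.
Proof.
move=> v0; rewrite lt_neqAle vnorm_ge0 andbT eq_sym.
apply: contra v0 => /eqP v0; apply/eqP/matrixP => i j.
rewrite ord1 mxE; apply/eqP; rewrite -normc_eq0 -[_ == 0]andTb.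
by rewrite eq_le normc_ge0 andbT -v0 vnorm_coord.
Qed.

Lemma vnorm0 : vnorm p (0 : 'cV[R[i]]_m) = 0.
Proof.
apply/eqP; rewrite eq_le vnorm_ge0 andbT.
case: p p_ok => [q q0|_].
  apply: vnorm_le_expr => //; rewrite big1 ?expr0n ?gtn_eqF// => i _.
  by rewrite mxE Normc.normc0 expr0n gtn_eqF.
by apply: vnorm_oo_le => // i; rewrite mxE Normc.normc0.
Qed.

Lemma vnormZ_le (a : R[i]) v : vnorm p (a *: v) <= Normc.normc a * vnorm p v.
Proof.
case: p p_ok => [q q0|_].
  apply: vnorm_le_expr => //; first by rewrite mulr_ge0 ?normc_ge0 ?(@powR_ge0 R).
  rewrite exprMn vnorm_expr// mulr_sumr; apply: ler_sum => i _.
  by rewrite mxE Normc.normcM exprMn.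
apply: vnorm_oo_le => [|i].
  by rewrite mulr_ge0 ?normc_ge0// bigmax_ge_id.
by rewrite mxE Normc.normcM ler_wpM2l ?normc_ge0 ?vnorm_oo_ge.
Qed.

Lemma vnormZ (a : R[i]) v : vnorm p (a *: v) = Normc.normc a * vnorm p v.
Proof.
have [->|a0] := eqVneq a 0.
  by rewrite scale0r Normc.normc0 mul0r vnorm0.
apply/eqP; rewrite eq_le vnormZ_le /=.
have := vnormZ_le a^-1 (a *: v); rewrite scalerA mulVf// scale1r Normc.normcV.
rewrite ler_pdivlMl//.
by rewrite lt_neqAle normc_ge0 eq_sym normc_eq0 a0.
Qed.

(** For finite exponents this is Minkowski's inequality, obtained from the
    convexity of the power function applied to the normalized vectors. *)
Lemma vnormD u v : vnorm p (u + v) <= vnorm p u + vnorm p v.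
Proof.
have [->|u0] := eqVneq u 0; first by rewrite add0r vnorm0 add0r.
have [->|v0] := eqVneq v 0; first by rewrite addr0 vnorm0 addr0.
move: (vnorm_gt0 u0) (vnorm_gt0 v0); case: p p_ok => [q q0|_]; last first.
  move=> U0 V0; apply: vnorm_oo_le => [|i]; first by rewrite addr_ge0 ?ltW.
  by rewrite mxE (le_trans (normcD _ _))// lerD// vnorm_oo_ge.
have := vnorm_expr u q0; have := vnorm_expr v q0.
move: (vnorm (Some q) u) (vnorm (Some q) v) => a b Sv Su a0 b0.
have ab0 : 0 < a + b by rewrite addr_gt0.
apply: vnorm_le_expr => //; first exact: ltW.
apply: (@le_trans _ _ (\sum_(i < m) (a + b) ^+ q *
   (a / (a + b) * (Normc.normc (u i 0) ^+ q / a ^+ q) +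
    b / (a + b) * (Normc.normc (v i 0) ^+ q / b ^+ q)))).
  apply: ler_sum => i _; rewrite mxE.
  apply: (@le_trans _ _ ((Normc.normc (u i 0) + Normc.normc (v i 0)) ^+ q)).
    apply: lerXn2r; rewrite ?nnegrE ?addr_ge0 ?normc_ge0//.
    exact: normcD.
  rewrite -!expr_div_n.
  apply: le_trans (ler_wpM2l _ (@convex_exprn q (a / (a + b)) (b / (a + b))
    (Normc.normc (u i 0) / a) (Normc.normc (v i 0) / b) _ _ _ _ _ q0));
    rewrite ?divr_ge0 ?exprn_ge0 ?normc_ge0 ?(ltW ab0) ?(ltW a0) ?(ltW b0)//.
    rewrite -exprMn le_eqVlt; apply/orP; left; apply/eqP; congr (_ ^+ _).
    by field; rewrite !gt_eqF.
  by rewrite -mulrDl divff ?gt_eqF.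
rewrite -mulr_sumr big_split /= -!mulr_sumr -!mulr_suml -Su -Sv.
rewrite !divff ?expf_neq0 ?gt_eqF// !mulr1 -mulrDl divff ?gt_eqF//.
by rewrite mulr1.
Qed.

End VectorNorm.

Section OperatorNorm.
Context {R : realType} {p : exponent} {m : nat}.
Hypothesis p_ok : valid_exponent p.
Implicit Types A B : 'M[R[i]]_m.

(** The quotients whose supremum defines the operator norm are bounded. *)
Lemma vnorm_mulmx_bounded A :
  exists2 K : R, 0 <= K & forall v, vnorm p (A *m v) <= K * vnorm p v.
Proof.
pose S := \sum_(i < m) \sum_(j < m) Normc.normc (A i j).
pose ones : 'cV[R[i]]_m := const_mx 1.
have S0 : 0 <= S by do 2!(apply: sumr_ge0 => ? _); exact: normc_ge0.
exists (S * vnorm p ones) => [|v]; first by rewrite mulr_ge0 ?vnorm_ge0.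
rewrite mulrAC.
have c0 : 0 <= S * vnorm p v by rewrite mulr_ge0 ?vnorm_ge0.
have := vnormZ p_ok (S * vnorm p v)%:C ones.
rewrite normc_real ger0_norm// => <-; apply: vnorm_mono => // i.
rewrite !mxE mulr1 normc_real ger0_norm//.
apply: le_trans (normc_sum _ _ _) _.
have SiS : \sum_(j < m) Normc.normc (A i j) <= S.
  rewrite /S [leRHS](bigD1 i)//= lerDl.
  by do 2!(apply: sumr_ge0 => ? _); exact: normc_ge0.
apply: le_trans (ler_wpM2r (vnorm_ge0 p v) SiS).
rewrite mulr_suml; apply: ler_sum => j _.
by rewrite Normc.normcM ler_wpM2l ?normc_ge0// vnorm_coord.
Qed.

Lemma opnorm_le A (K : R) : 0 <= K ->
  (forall v, vnorm p (A *m v) <= K * vnorm p v) -> opnorm p A <= K.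
Proof.
move=> K0 AK; rewrite /opnorm; set E := (X in sup X).
have [->|E0] := eqVneq E set0; first by rewrite sup0.
apply: ge_sup; first exact/set0P.
by move=> _ [v /= v0 <-]; rewrite ler_pdivrMr ?vnorm_gt0.
Qed.

Lemma vnorm_mulmx A v : vnorm p (A *m v) <= opnorm p A * vnorm p v.
Proof.
have [->|v0] := eqVneq v 0; first by rewrite mulmx0 !vnorm0// mulr0.
rewrite -ler_pdivrMr ?vnorm_gt0//; apply: ub_le_sup; last by exists v.
have [K K0 AK] := vnorm_mulmx_bounded A.
by exists K => _ [w /= w0 <-]; rewrite ler_pdivrMr ?vnorm_gt0.
Qed.

Lemma opnorm_ge0 A : 0 <= opnorm p A.
Proof.
rewrite /opnorm; set E := (X in sup X).
have [->|/set0P[x [v v0 _]]] := eqVneq E set0; first by rewrite sup0.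
by have := le_trans (vnorm_ge0 p (A *m v)) (vnorm_mulmx A v);
  rewrite pmulr_lge0 ?vnorm_gt0.
Qed.

Lemma opnormM A B : opnorm p (A *m B) <= opnorm p A * opnorm p B.
Proof.
apply: opnorm_le => [|v]; first by rewrite mulr_ge0 ?opnorm_ge0.
rewrite -mulmxA -mulrA (le_trans (vnorm_mulmx _ _))//.
by rewrite ler_wpM2l ?opnorm_ge0 ?vnorm_mulmx.
Qed.

Lemma opnormD A B : opnorm p (A + B) <= opnorm p A + opnorm p B.
Proof.
apply: opnorm_le => [|v]; first by rewrite addr_ge0 ?opnorm_ge0.
by rewrite mulmxDl mulrDl (le_trans (vnormD p_ok _ _))// lerD ?vnorm_mulmx.
Qed.

Lemma opnormZ (a : R[i]) A : opnorm p (a *: A) <= Normc.normc a * opnorm p A.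
Proof.
apply: opnorm_le => [|v]; first by rewrite mulr_ge0 ?normc_ge0 ?opnorm_ge0.
by rewrite -scalemxAl vnormZ// -mulrA ler_wpM2l ?normc_ge0 ?vnorm_mulmx.
Qed.

Lemma opnorm0 : opnorm p (0 : 'M[R[i]]_m) = 0.
Proof.
apply/eqP; rewrite eq_le opnorm_ge0 andbT.
by apply: opnorm_le => // v; rewrite mul0mx vnorm0// mul0r.
Qed.

Lemma opnorm1 : opnorm p (1%:M : 'M[R[i]]_m) <= 1.
Proof. by apply: opnorm_le => // v; rewrite mul1mx mul1r. Qed.

Lemma opnorm_sum (I : Type) (r : seq I) (P : pred I) (F : I -> 'M[R[i]]_m) :
  opnorm p (\sum_(i <- r | P i) F i) <= \sum_(i <- r | P i) opnorm p (F i).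
Proof.
elim/big_rec2: _ => [|i a z _ le_za]; first by rewrite opnorm0.
by rewrite (le_trans (opnormD _ _))// lerD2l.
Qed.

(** Replacing the entries of [v] by their moduli does not change its norm, so
    entrywise domination by a nonnegative matrix bounds the operator norm. *)
Lemma opnorm_dominated A (B : 'M[R]_m) :
  (forall i j, Normc.normc (A i j) <= B i j) ->
  opnorm p A <= opnorm p (cplx_mx B).
Proof.
move=> AB; apply: opnorm_le => [|v]; first exact: opnorm_ge0.
pose w : 'cV[R[i]]_m := \col_i (Normc.normc (v i 0))%:C.
have vw : vnorm p w <= vnorm p v.
  by apply: vnorm_mono => // i; rewrite mxE normc_real ger0_norm ?normc_ge0.
apply: le_trans (ler_wpM2l (opnorm_ge0 _) vw).
apply: le_trans (vnorm_mulmx _ _); apply: vnorm_mono => // i; rewrite !mxE.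
have -> : \sum_j cplx_mx B i j * w j 0 =
    (\sum_j B i j * Normc.normc (v j 0))%:C.
  by rewrite rmorph_sum; apply: eq_bigr => j _; rewrite !mxE rmorphM.
rewrite normc_real; apply: le_trans (ler_norm _).
apply: le_trans (normc_sum _ _ _) _; apply: ler_sum => j _.
by rewrite Normc.normcM ler_wpM2r ?normc_ge0.
Qed.

Lemma opnorm_gt0 A : A != 0 -> 0 < opnorm p A.
Proof.
move=> A0; rewrite lt_neqAle opnorm_ge0 andbT eq_sym.
apply: contra A0 => /eqP A0; apply/eqP/matrixP => i j; rewrite mxE.
have := vnorm_mulmx A (delta_mx j 0); rewrite A0 mul0r => Aj.
have := le_trans (vnorm_coord p_ok _ i) Aj; rewrite -colE mxE => Aij.
by apply/eqP; rewrite -normc_eq0 eq_le normc_ge0 andbT.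
Qed.

Lemma opnorm_exp (X : 'M[R[i]]_m) (mu : R) k :
  opnorm p X <= mu -> opnorm p (iter k (mulmx X) 1%:M) <= mu ^+ k.
Proof.
move=> Xmu; elim: k => [|k IH] /=; first by rewrite expr0 opnorm1.
rewrite exprS (le_trans (opnormM _ _))// ler_pM ?opnorm_ge0//.
Qed.

(** The telescoping bound for the difference of two powers. *)
Lemma opnorm_exp_sub (X Y : 'M[R[i]]_m) (mu e : R) k :
  opnorm p X <= mu -> opnorm p Y <= mu -> opnorm p (X - Y) <= e ->
  opnorm p (iter k (mulmx X) 1%:M - iter k (mulmx Y) 1%:M)
    <= e * (k%:R * mu ^+ k.-1).
Proof.
move=> Xmu Ymu XYe; have e0 := le_trans (opnorm_ge0 _) XYe.
have mu0 := le_trans (opnorm_ge0 _) Xmu.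
elim: k => [|k IH]; first by rewrite subrr opnorm0 mul0r mulr0.
rewrite [iter _ _ _]iterS [iter k.+1 (mulmx Y) _]iterS /=.
move: IH; set Xk := iter k _ _; set Yk := iter k _ _ => IH.
have -> : X *m Xk - Y *m Yk = X *m (Xk - Yk) + (X - Y) *m Yk.
  by rewrite mulmxBr mulmxBl addrA subrK.
apply: le_trans (opnormD _ _) _.
have -> : e * (k.+1%:R * mu ^+ k) = mu * (e * (k%:R * mu ^+ k.-1)) + e * mu ^+ k.
  case: k {IH Xk Yk} => [|k] /=; first by ring.
  by rewrite exprS -[k.+2%:R]natr1; ring.
apply: lerD; apply: le_trans (opnormM _ _) _; apply: ler_pM;
  rewrite ?opnorm_ge0//.
exact: opnorm_exp.
Qed.

End OperatorNorm.

(** * Hermite interpolation *)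

Section Hermite.
Context {F : closedFieldType}.
Hypothesis F0 : [pchar F] =i pred0.
Implicit Types (s : seq F) (q u : {poly F}) (b c : F).

Lemma derivn_XsubC_mul q b c k :
  (('X - c%:P) * q)^`(k).[b] = (b - c) * q^`(k).[b] + q^`(k.-1).[b] *+ k.
Proof.
have main : forall j, (('X - c%:P) * q)^`(j) =
    ('X - c%:P) * q^`(j) + q^`(j.-1) *+ j.
  elim=> [|j IH]; first by rewrite !derivn0 mulr0n addr0.
  rewrite derivnS IH derivD derivM derivXsubC mul1r derivMn -!derivnS /=.
  case: j {IH} => [|j]; first by rewrite mulr0n addr0 addrC mulr1n.
  by rewrite [in RHS]mulrS addrCA /= -!derivnS -addrA.
by rewrite main !hornerE hornerMn.
Qed.

(** The product [P] of the factors [X - c] vanishes at [b] to the order [k0] of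
    multiplicity of [b] in [s], and the [k0]-th derivative of [P * u] at [b] sees
    only the value [u.[b]], with a nonzero factor. *)
Lemma derivn_prod_XsubC s b : exists2 C : F, C != 0 & forall u,
  (forall k, (k < count_mem b s)%N ->
     ((\prod_(c <- s) ('X - c%:P)) * u)^`(k).[b] = 0) /\
  ((\prod_(c <- s) ('X - c%:P)) * u)^`(count_mem b s).[b] = C * u.[b].
Proof.
elim: s => [|c s [C C0 IH]].
  exists 1 => [|u]; first exact: oner_neq0.
  by split=> //; rewrite big_nil !mul1r derivn0.
rewrite /=; have [cb|bc] := eqVneq c b.
  subst c.
  exists (C * (count_mem b s).+1%:R) => [|u].
    by rewrite mulf_neq0//; move/pcharf0P: F0 => ->.
  have {IH}[IH1 IH2] := IH u.
  split=> [k|]; rewrite add1n.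
    rewrite big_cons -mulrA derivn_XsubC_mul subrr mul0r add0r.
    by case: k => [|k] kc; rewrite ?mulr0n//= IH1 ?mul0rn.
  rewrite big_cons -mulrA derivn_XsubC_mul subrr mul0r add0r /= IH2.
  by rewrite -mulr_natr mulrAC.
exists ((b - c) * C) => [|u].
  by rewrite mulf_neq0// subr_eq0 eq_sym.
have {IH}[IH1 IH2] := IH u.
split=> [k|]; rewrite add0n.
  move=> kc; rewrite big_cons -mulrA derivn_XsubC_mul IH1// mulr0 add0r.
  by rewrite IH1 ?mul0rn// (leq_ltn_trans (leq_pred k)).
rewrite big_cons -mulrA derivn_XsubC_mul IH2 mulrA.
case: (count_mem b s) IH1 => [|k] IH1; first by rewrite mulr0n addr0.
by rewrite /= IH1// mul0rn addr0.
Qed.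

(** Adding one node [b] corrects the jet of highest order at [b] by a multiple of
    the product of the previous factors. *)
Lemma hermite_exists s (v : F -> nat -> F) :
  exists q, forall a k, (k < count_mem a s)%N -> q^`(k).[a] = v a k.
Proof.
elim: s => [|b s [q IH]]; first by exists 0.
pose P := \prod_(c <- s) ('X - c%:P).
have [C C0 PC] := derivn_prod_XsubC s b.
pose w := (v b (count_mem b s) - q^`(count_mem b s).[b]) / C.
exists (q + P * w%:P) => a k /=; rewrite derivnD hornerD.
have [<-|ba] := eqVneq b a; last first.
  rewrite add0n => ka; rewrite IH//.
  have [D _ /(_ w%:P)[D0 _]] := derivn_prod_XsubC s a.
  by rewrite D0// addr0.
rewrite add1n ltnS leq_eqVlt => /orP[/eqP ->|kb].
  have [_ ->] := PC w%:P.
  by rewrite hornerC /w mulrCA divff// mulr1 addrC subrK.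
have [D0 _] := PC w%:P.
by rewrite IH// D0// addr0.
Qed.

(** Newton's form of Hermite interpolation: modulo the product of the factors
    [X - c], a polynomial is a fixed linear combination of its jets. *)
Lemma hermite_newton s : exists L : seq (F * nat * {poly F}),
  all (fun t => (t.1.2 < count_mem t.1.1 s)%N) L /\
  forall q, \prod_(c <- s) ('X - c%:P) %|
    q - \sum_(t <- L) q^`(t.1.2).[t.1.1] *: t.2.
Proof.
elim: s => [|b s [L [Lok IH]]].
  by exists [::]; split=> // q; rewrite big_nil dvd1p.
set P := \prod_(c <- s) ('X - c%:P) in IH.
have [C C0 PC] := derivn_prod_XsubC s b.
pose k0 := count_mem b s; pose P' := C^-1 *: P.
exists ((b, k0, P') :: [seq (t.1, t.2 - t.2^`(k0).[b] *: P') | t <- L]); split.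
  rewrite /= eqxx add1n leqnn /= all_map; apply/allP => t tL /=.
  by rewrite (leq_trans (allP Lok t tL))// leq_addl.
move=> q; have /dvdpP[u qE] := IH q.
(* The next divided difference [u.[b]] is again a combination of jets of [q]. *)
have ub : C * u.[b] =
    q^`(k0).[b] - \sum_(t <- L) q^`(t.1.2).[t.1.1] * t.2^`(k0).[b].
  have [_ <-] := PC u; rewrite -/P mulrC -qE derivnB hornerD hornerN.
  rewrite -/k0; congr (_ - _).
  have -> : (\sum_(t <- L) q^`(t.1.2).[t.1.1] *: t.2)^`(k0) =
     \sum_(t <- L) q^`(t.1.2).[t.1.1] *: t.2^`(k0).
    by rewrite raddf_sum; apply: eq_bigr => t _; exact: derivnZ.
  by rewrite horner_sum; apply: eq_bigr => t _; rewrite hornerZ.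
rewrite !big_cons big_map /= -/P.
have -> : q - (q^`(k0).[b] *: P' + \sum_(t <- L) q^`(t.1.2).[t.1.1] *:
    (t.2 - t.2^`(k0).[b] *: P')) = (u - u.[b]%:P) * P.
  have -> : \sum_(t <- L) q^`(t.1.2).[t.1.1] *: (t.2 - t.2^`(k0).[b] *: P') =
     \sum_(t <- L) q^`(t.1.2).[t.1.1] *: t.2 -
     (\sum_(t <- L) q^`(t.1.2).[t.1.1] * t.2^`(k0).[b]) *: P'.
    rewrite scaler_suml -sumrB; apply: eq_bigr => t _.
    by rewrite scalerBr scalerA.
  rewrite mulrBl -qE mul_polyC.
  have -> : u.[b] *: P = (C * u.[b]) *: P'.
    by rewrite /P' scalerA mulrAC divff// mul1r.
  rewrite ub scalerBl !opprD !opprK !addrA [LHS]addrAC.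
  by rewrite [in LHS]addrAC; congr (_ + _); rewrite addrAC.
by rewrite dvdp_mul2r ?dvdp_XsubCl ?rootE ?hornerE ?subrr//
  monic_neq0// monic_prod_XsubC.
Qed.

End Hermite.

(** * Differential calculus on the real line *)

Section RealCalculus.
Context {R : realType}.
Implicit Types (f g df : R -> R) (a b c x : R).

Lemma is_derive_add f g x a b : is_derive x (1 : R) f a ->
  is_derive x (1 : R) g b -> is_derive x (1 : R) (fun t => f t + g t) (a + b).
Proof. exact: is_deriveD. Qed.

Lemma is_derive_mul f g x a b : is_derive x (1 : R) f a ->
  is_derive x (1 : R) g b ->
  is_derive x (1 : R) (fun t => f t * g t) (a * g x + f x * b).
Proof.
by move=> df dg; rewrite addrC [a * _]mulrC; exact: is_deriveM.
Qed.

Lemma is_derive_scale c f x a : is_derive x (1 : R) f a ->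
  is_derive x (1 : R) (fun t => c * f t) (c * a).
Proof.
move=> df; have := is_derive_mul (is_derive_cst c x (1 : R)) df.
by rewrite mul0r add0r.
Qed.

Lemma is_derive_sum (I : Type) (r : seq I) (f : I -> R -> R) (d : I -> R) x :
  (forall i, is_derive x (1 : R) (f i) (d i)) ->
  is_derive x (1 : R) (fun t => \sum_(i <- r) f i t) (\sum_(i <- r) d i).
Proof.
move=> df; elim: r => [|i r IH].
  rewrite big_nil; under eq_fun do rewrite big_nil.
  exact: is_derive_cst.
rewrite big_cons; under eq_fun do rewrite big_cons.
exact: is_derive_add.
Qed.

Lemma is_derive_expR_comp f x a : is_derive x (1 : R) f a ->
  is_derive x (1 : R) (fun t => expR (f t)) (a * expR (f x)).
Proof.
by move=> df; rewrite mulrC; exact: (is_derive1_comp (f := expR)).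
Qed.

Lemma is_derive_expR_lin c x :
  is_derive x (1 : R) (fun t => expR (c * t)) (c * expR (c * x)).
Proof.
apply: is_derive_expR_comp; rewrite -[X in is_derive _ _ _ X](mulr1 c).
by apply: is_derive_scale; exact: is_derive_id.
Qed.

Lemma is_derive_exprn n x :
  is_derive x (1 : R) (fun t => t ^+ n) (n%:R * x ^+ n.-1).
Proof.
have := is_deriveX n (is_derive_id x (1 : R)).
rewrite /GRing.scale /= mulr1 (_ : id ^+ n = (fun t => t ^+ n))//.
by apply/funext => t; rewrite exprfctE.
Qed.

Lemma is_derive_continuous f df :
  (forall x, is_derive x (1 : R) f (df x)) -> continuous f.
Proof.
move=> H x; apply: differentiable_continuous; apply/derivable1_diffP.
by have [] := H x.
Qed.

Lemma continuous_expR_lin c : continuous (fun t : R => expR (c * t)).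
Proof. by apply: is_derive_continuous => x; exact: is_derive_expR_lin. Qed.

(** A function which is nonnegative at the origin and nondecreasing to the
    right of it is nonnegative there. *)
Lemma derive_ge0 f df : (forall x, is_derive x (1 : R) f (df x)) ->
  (forall x, 0 <= x -> 0 <= df x) -> 0 <= f 0 ->
  forall x, 0 <= x -> 0 <= f x.
Proof.
move=> H df0 f0 x x0.
have cf : {within `[0, x], continuous f}%classic.
  by apply: continuous_subspaceT; exact: is_derive_continuous H.
have [c] := MVT_segment x0 (fun y _ => H y) cf.
rewrite in_itv /= => /andP[c0 _] fx.
by rewrite -[f x](subrK (f 0)) fx addr_ge0// mulr_ge0 ?subr0 ?df0.
Qed.

Lemma powerseries_le_expR N x : 0 <= x ->
  \sum_(j < N) x ^+ j / j`!%:R <= expR x.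
Proof.
elim: N x => [|N IH] x x0; first by rewrite big_ord0 expR_ge0.
rewrite -subr_ge0.
apply: (@derive_ge0 (fun t => expR t - \sum_(j < N.+1) t ^+ j / j`!%:R)
  (fun t => expR t - \sum_(j < N) t ^+ j / j`!%:R)) => //.
- move=> y; apply: is_derive_add.
  rewrite -mulN1r; under eq_fun do rewrite -mulN1r.
  apply: is_derive_scale.
  have -> : \sum_(j < N) y ^+ j / j`!%:R =
      \sum_(j < N.+1) (j%:R * y ^+ j.-1) / j`!%:R.
    rewrite big_ord_recl mul0r mul0r add0r; apply: eq_bigr => j _ /=.
    rewrite /bump /= add1n /= factS natrM; field.
    by rewrite nat1r !pnatr_eq0 /= -lt0n fact_gt0.
  apply: is_derive_sum => j.
  rewrite mulrC; under eq_fun do rewrite mulrC.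
  by apply: is_derive_scale; exact: is_derive_exprn.
- by move=> y y0; rewrite subr_ge0 IH.
- rewrite big_ord_recl /= expr0 fact0 divr1 expR0 big1 ?addr0 ?subrr// => j _.
  by rewrite exprS mul0r mul0r.
Qed.

Lemma exprn_le_expR k x : 0 <= x -> x ^+ k <= k`!%:R * expR x.
Proof.
move=> x0; rewrite mulrC -ler_pdivrMr ?ltr0n ?fact_gt0//.
apply: le_trans (powerseries_le_expR k.+1 x0).
rewrite big_ord_recr /= lerDr sumr_ge0// => j _.
by rewrite divr_ge0// exprn_ge0.
Qed.

Lemma expRN_le x : 0 <= x -> expR (- x) <= 1 - x + x ^+ 2 / 2.
Proof.
move=> x0; rewrite -subr_ge0.
have dexp y : is_derive y (1 : R) (fun t => - 1 * expR (-1 * t))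
    (expR (- y)).
  have -> : expR (- y) = -1 * (-1 * expR (-1 * y)) by rewrite !mulN1r opprK.
  by apply: is_derive_scale; exact: is_derive_expR_lin.
have H1 (y : R) : 0 <= y -> 0 <= -1 + y + expR (- y).
  by move=> y0; have := expR_ge1Dx (- y); lra.
have -> : 1 - x + x ^+ 2 / 2 - expR (- x) =
    1 + -1 * x + 2^-1 * x ^+ 2 + -1 * expR (-1 * x).
  by rewrite !mulN1r [2^-1 * _]mulrC.
apply: (@derive_ge0 (fun t => 1 + -1 * t + 2^-1 * t ^+ 2 + -1 * expR (-1 * t))
   (fun t => -1 + t + expR (- t))) => //.
  move=> y; apply: is_derive_add.
  have -> : -1 + y = 0 + -1 * 1 + 2^-1 * (2%:R * y ^+ 1) :> R.
    by rewrite expr1 mulrA mulVf ?pnatr_eq0// mul1r add0r mulr1.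
  apply: is_derive_add.
  by apply: is_derive_scale; exact: is_derive_exprn.
Qed.

Lemma cosh1_gt : 1 / 2 < cosh (1 : R) - 1.
Proof.
have := @powerseries_le_expR 4 1 ler01.
rewrite !big_ord_recr big_ord0 /= !expr1n !divr1 !mul1r add0r.
have -> : 3`! = 6 by []. have -> : 2`! = 2 by [].
rewrite /cosh expRN; move: (expR 1) => e He.
have e0 : 0 < e by lra.
rewrite ltrBrDr ltr_pdivlMr//.
have -> : e + e^-1 = (e ^+ 2 + 1) / e by field; rewrite gt_eqF.
rewrite ltr_pdivlMr//; nra.
Qed.

End RealCalculus.

(** * Euler's integral in the logarithmic variable *)

Section GammaIntegral.
Context {R : realType}.
Local Open Scope classical_set_scope.
Local Open Scope ring_scope.
Notation lmu := (@lebesgue_measure R).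
Implicit Types (h g gam G : R -> R) (a b c C kap s t : R) (k : nat).

(** The integral over the half-line of [expR (- t) * h (ln t)]: Euler's integral
    in the logarithmic variable [s = ln t]. *)
Definition eint (h : R -> R) : R :=
  Rintegral lmu `]0, +oo[ (fun t : R => expR (- t) * h (ln t)).

(** Integrability of the integrand of [eint h]. *)
Definition eintegrable (h : R -> R) : Prop :=
  lmu.-integrable `]0, +oo[ (EFin \o (fun t : R => expR (- t) * h (ln t))).

Let mhalf : @measurable _ (measurableTypeR R) `]0%R, +oo[.
Proof. exact: measurable_itv. Qed.

Lemma emeasurable (D : set R) h : measurable_fun setT h ->
  measurable_fun D (fun t => expR (- t) * h (ln t)).
Proof.
move=> mh; apply: measurable_funTS; apply: measurable_funM.
  by apply: measurableT_comp => //; exact: oppr_measurable.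
by apply: measurableT_comp => //; exact: measurable_ln.
Qed.

Lemma is_derive_comp_ln gam G t : 0 < t ->
  is_derive (ln t) (1 : R) G (gam (ln t)) ->
  is_derive t (1 : R) (fun u => G (ln u)) (gam (ln t) * expR (- ln t)).
Proof.
move=> t0 dG; rewrite expRN lnK//.
exact: (is_derive1_comp (f := G) (g := @ln R) dG (is_derive1_ln t0)).
Qed.

(** If [G] is an antiderivative of [gam] then [G (ln t)] is one of
    [gam (ln t) / t]; exhausting [D] by compact intervals bounds the integral of
    the latter by the increments of [G]. *)
Lemma integral_ln_le gam G (al be : nat -> R) (D : set R) C :
  (forall s, is_derive s (1 : R) G (gam s)) -> continuous gam ->
  (forall n, al n < be n) ->
  nonincreasing_seq al -> nondecreasing_seq be ->
  D = \bigcup_n [set` `[expR (al n), expR (be n)]] ->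
  (forall n s, al n <= s <= be n -> 0 <= gam s) ->
  (forall n, G (be n) - G (al n) <= C) ->
  (\int[lmu]_(t in D) (gam (ln t) * expR (- ln t))%:E <= C%:E)%E.
Proof.
move=> dG cgam albe ial ibe DE gam0 GC.
pose Fn n : set R := [set` `[expR (al n), expR (be n)]].
have pos n t : Fn n t -> 0 < t.
  by rewrite /Fn /= in_itv /= => /andP[+ _]; apply: lt_le_trans; rewrite expR_gt0.
have cfull t : 0 < t -> {for t, continuous (fun u => gam (ln u) * expR (- ln u))}.
  move=> t0; apply: cvgM.
    by apply: continuous_comp; [exact: continuous_ln|exact: cgam].
  apply: continuous_comp; last exact: continuous_expR.
  by apply: cvgN; exact: continuous_ln.
have mg : measurable_fun setT (fun t => (gam (ln t) * expR (- ln t))%:E).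
  apply/measurable_EFinP; apply: measurable_funM.
    apply: measurableT_comp; last exact: measurable_ln.
    exact: continuous_measurable_fun.
  apply: measurableT_comp => //; apply: measurableT_comp.
    exact: oppr_measurable.
  exact: measurable_ln.
have cv : (\int[lmu]_(t in Fn n) (gam (ln t) * expR (- ln t))%:E @[n --> \oo]
    --> \int[lmu]_(t in D) (gam (ln t) * expR (- ln t))%:E)%E.
  rewrite DE; apply: ge0_nondecreasing_set_cvg_integral.
  - move=> m n mn; apply/subsetPset => t; rewrite /Fn /= !in_itv /= => /andP[a b].
    rewrite (le_trans _ a) ?ler_expR ?ial//= (le_trans b)// ler_expR.
    exact: ibe.
  - by move=> n; exact: measurable_itv.
  - by move=> n; exact: measurable_funTS.
  - move=> n t Fnt; rewrite lee_fin mulr_ge0 ?expR_ge0//.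
    apply: (gam0 n); have t0 := pos _ _ Fnt.
    move: Fnt; rewrite /Fn /= in_itv /= => /andP[a b].
    by rewrite -[al n]expRK -[be n]expRK !ler_ln ?posrE ?expR_gt0// a.
rewrite -(cvg_lim _ cv)//; apply: lime_le; first exact: cvgP cv.
apply: nearW => n.
have cG t : 0 < t -> {for t, continuous (fun u => G (ln u))}.
  move=> t0; apply: differentiable_continuous; apply/derivable1_diffP.
  by have [] := is_derive_comp_ln t0 (dG (ln t)).
rewrite (continuous_FTC2 (F := fun u => G (ln u))).
- by rewrite -EFinB lee_fin !expRK.
- by rewrite ltr_expR.
- apply: continuous_in_subspaceT => t; rewrite inE => /(pos n).
  exact: cfull.
- split.
  + move=> t; rewrite in_itv /= => /andP[at0 _].
    have t0 : 0 < t := lt_trans (expR_gt0 _) at0.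
    by have [] := is_derive_comp_ln t0 (dG (ln t)).
  + by apply: cvg_at_right_filter; apply: cG; exact: expR_gt0.
  + by apply: cvg_at_left_filter; apply: cG; exact: expR_gt0.
- move=> t; rewrite in_itv /= => /andP[at0 _].
  have t0 : 0 < t := lt_trans (expR_gt0 _) at0.
  by rewrite derive1E; have [] := is_derive_comp_ln t0 (dG (ln t)).
Qed.

(** The weight [t^(a-1) / (1 + t^a)^2] has the bounded antiderivative
    [- 1 / (a (1 + t^a))] and, up to a constant factor, dominates [expR (- t) t^(a-1)]. *)
Lemma eintegrable_expR a : 0 < a -> eintegrable (fun s => expR ((a - 1) * s)).
Proof.
move=> a0; pose gam s : R := expR (a * s) / (1 + expR (a * s)) ^+ 2.
pose G s : R := - a^-1 * (1 + expR (a * s))^-1.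
have den s : 0 < 1 + expR (a * s) by rewrite addr_gt0// expR_gt0.
have dG s : is_derive s (1 : R) G (gam s).
  rewrite /G (_ : gam s = - a^-1 *
      (- (1 + expR (a * s)) ^- 2 *: (0 + a * expR (a * s)))); last first.
    by rewrite /GRing.scale /= /gam; field; rewrite !gt_eqF.
  apply: is_derive_scale; apply: is_deriveV; first by rewrite gt_eqF.
  apply: is_derive_add; exact: is_derive_expR_lin.
have cexp := @continuous_expR_lin R a.
have cgam : continuous gam.
  move=> s; apply: cvgM; first exact: cexp.
  apply: cvgV; first by rewrite expf_neq0 ?gt_eqF.
  apply: (@continuous_comp _ _ _ (fun s : R => 1 + expR (a * s))
    (fun x : R => x ^+ 2)); last exact: exprn_continuous.
  by apply: cvgD; [exact: cvg_cst|exact: cexp].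
have gam0 s : 0 <= gam s by rewrite divr_ge0 ?exprn_ge0 ?expR_ge0// ltW.
have Gle s t : G s - G t <= a^-1.
  have : 0 <= a^-1 * (1 + expR (a * s))^-1 by rewrite mulr_ge0 ?invr_ge0 ?ltW.
  have : a^-1 * (1 + expR (a * t))^-1 <= a^-1.
    rewrite ger_pMr ?invr_gt0// invf_le1// lerDl expR_ge0//.
  by rewrite /G !mulNr; lra.
have intg : (\int[lmu]_(t in `]0%R, +oo[) (gam (ln t) * expR (- ln t))%:E
    <= (a^-1)%:E)%E.
  apply: (@integral_ln_le gam G (fun n => - n.+1%:R) (fun n => n.+1%:R)) => //.
  - by move=> n; rewrite gtrN.
  - by move=> m n mn; rewrite lerN2 ler_nat.
  - by move=> m n mn; rewrite ler_nat.
  - rewrite eqEsubset; split=> t; rewrite /= in_itv /= ?andbT.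
      move=> t0; exists (Num.truncn `|ln t|) => //=.
      rewrite in_itv /= -{2 3}(@lnK _ t)// !ler_expR.
      have : `|ln t| <= (Num.truncn `|ln t|).+1%:R.
        by rewrite ltW// truncnS_gt.
      by rewrite ler_norml.
    move=> [n _]; rewrite /= in_itv /= => /andP[+ _].
    by apply: lt_le_trans; rewrite expR_gt0.
(* By [ln x < x] at [x = t / (2 a)], one has [t^a <= K0 * exp(t / 2)]. *)
pose K0 := expR (a * ln (a *+ 2)).
have K00 : 0 <= K0 := expR_ge0 _.
apply: (@le_integrable _ _ _ lmu `]0%R, +oo[ _ _
  (fun t => ((1 + K0) ^+ 2)%:E * (gam (ln t) * expR (- ln t))%:E)%E).
- exact: measurable_itv.
- apply/measurable_EFinP; apply: (@emeasurable _ (fun s => expR ((a - 1) * s))).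
  apply: continuous_measurable_fun; exact: continuous_expR_lin.
- move=> t; rewrite /= in_itv /= andbT => t0.
  rewrite lee_fin !ger0_norm ?mulr_ge0 ?expR_ge0 ?exprn_ge0 ?addr_ge0//.
  have -> : expR ((a - 1) * ln t) = expR (a * ln t) * expR (- ln t).
    by rewrite -expRD mulrBl mul1r.
  rewrite !mulrA ler_wpM2r ?expR_ge0//.
  rewrite /gam ler_pdivlMr ?exprn_gt0// mulrAC ler_wpM2r ?expR_ge0//.
  have le1 : 1 + expR (a * ln t) <= (1 + K0) * expR (t / 2).
    rewrite mulrDl mul1r; apply: lerD.
      by rewrite -expR0 ler_expR divr_ge0 ?ltW.
    rewrite /K0 -expRD ler_expR.
    have a2 : 0 < a *+ 2 by rewrite mulrn_wgt0.
    have -> : ln t = ln (a *+ 2) + ln (t / (a *+ 2)).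
      by rewrite -lnM ?posrE ?divr_gt0// mulrCA divff ?mulr1// gt_eqF.
    rewrite mulrDr lerD2l.
    have := ln_sublinear (divr_gt0 t0 a2) => /ltW /(ler_wpM2l (ltW a0)).
    move/le_trans; apply; rewrite le_eqVlt; apply/orP; left; apply/eqP.
    by field; rewrite gt_eqF.
  have -> : expR (- t) = (expR (t / 2) ^+ 2)^-1.
    rewrite -expRM_natl -expRN; congr (expR (- _)).
    by rewrite mulrCA divff ?mulr1// pnatr_eq0.
  rewrite mulrC ler_pdivrMr ?exprn_gt0 ?expR_gt0// -exprMn.
  by rewrite lerXn2r// nnegrE ?mulr_ge0 ?addr_ge0 ?expR_ge0// ltW.
- apply: integrableZl; first exact: measurable_itv.
  apply/integrableP; split.
    apply/measurable_EFinP; apply: measurable_funTS; apply: measurable_funM.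
      apply: measurableT_comp; last exact: measurable_ln.
      exact: continuous_measurable_fun.
    apply: measurableT_comp => //; apply: measurableT_comp.
      exact: oppr_measurable.
    exact: measurable_ln.
  under eq_integral => t _ do rewrite gee0_abs ?lee_fin ?mulr_ge0 ?expR_ge0//.
  exact: le_lt_trans intg (ltry _).
Qed.

Lemma eintegrableD h g : eintegrable h -> eintegrable g ->
  eintegrable (fun s => h s + g s).
Proof.
move=> ih ig; have := integrableD mhalf ih ig.
apply: eq_integrable; first exact: mhalf.
by move=> t _ /=; rewrite -EFinD mulrDr.
Qed.

Lemma eintegrableZ c h : eintegrable h -> eintegrable (fun s => c * h s).
Proof.
move=> ih; have := integrableZl mhalf c ih.
apply: eq_integrable; first exact: mhalf.
by move=> t _ /=; rewrite -EFinM mulrCA.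
Qed.

Lemma eintegrable_le h g : measurable_fun setT h ->
  (forall s, `|h s| <= g s) -> eintegrable g -> eintegrable h.
Proof.
move=> mh hg; apply: le_integrable; first exact: mhalf.
  by apply/measurable_EFinP; exact: emeasurable.
move=> t _ /=; rewrite lee_fin !normrM ler_wpM2l//.
exact: le_trans (hg _) (ler_norm _).
Qed.

Lemma eintD h g : eintegrable h -> eintegrable g ->
  eint (fun s => h s + g s) = eint h + eint g.
Proof.
move=> ih ig; rewrite /eint -(RintegralD mhalf ih ig).
by apply: eq_Rintegral => t _; rewrite mulrDr.
Qed.

Lemma eintZ c h : eintegrable h -> eint (fun s => c * h s) = c * eint h.
Proof.
move=> ih; rewrite /eint -(RintegralZl _ mhalf ih).
by apply: eq_Rintegral => t _; rewrite mulrCA.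
Qed.

Lemma eint_le h g : eintegrable h -> eintegrable g ->
  (forall s, h s <= g s) -> eint h <= eint g.
Proof.
move=> ih ig hg; apply: (le_Rintegral mhalf ih ig).
by move=> t _; rewrite ler_wpM2l ?expR_ge0.
Qed.

(** The weights [|s|^k exp(c s + kap |s|)] by which all integrands are bounded;
    their integral is finite as soon as [0 <= kap < c + 1]. *)
Definition ewt (k : nat) (c kap s : R) : R :=
  `|s| ^+ k * expR (c * s + kap * `|s|).

Lemma ewt_ge0 k c kap s : 0 <= ewt k c kap s.
Proof. by rewrite mulr_ge0 ?exprn_ge0 ?expR_ge0. Qed.

Lemma continuous_ewt k c kap : continuous (ewt k c kap).
Proof.
move=> s; apply: cvgM.
  apply: (@continuous_comp _ _ _ (fun s : R => `|s|) (fun x : R => x ^+ k)).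
    exact: norm_continuous.
  exact: exprn_continuous.
apply: continuous_comp; last exact: continuous_expR.
apply: cvgD; apply: cvgMr; first exact: cvg_id.
exact: norm_continuous.
Qed.

Lemma measurable_ewt k c kap : measurable_fun setT (ewt k c kap).
Proof. exact: continuous_measurable_fun (@continuous_ewt k c kap). Qed.

Lemma eintegrable_ewt k c kap : kap < c + 1 -> 0 <= kap ->
  eintegrable (ewt k c kap).
Proof.
move=> kc k0.
(* The power of [|s|] is absorbed in [exp(e |s|)], where [kap + e < c + 1]. *)
have [e e0 eE] : exists2 e, 0 < e & e * 2 = c + 1 - kap.
  by exists ((c + 1 - kap) / 2); [rewrite divr_gt0// subr_gt0|rewrite divfK].
pose b := e^-1 ^+ k * k`!%:R.
apply: (@eintegrable_le _ (fun s => b * (expR ((c + kap + e + 1 - 1) * s)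
   + expR ((c - kap - e + 1 - 1) * s)))).
- exact: measurable_ewt.
- move=> s; rewrite ger0_norm ?ewt_ge0// /ewt /b.
  have -> : `|s| ^+ k = e^-1 ^+ k * (e * `|s|) ^+ k.
    by rewrite -exprMn mulrA mulVf ?mul1r// gt_eqF.
  rewrite -!mulrA ler_wpM2l ?exprn_ge0 ?invr_ge0 ?(ltW e0)//.
  have := exprn_le_expR k (mulr_ge0 (ltW e0) (normr_ge0 s)).
  move=> /(ler_wpM2r (expR_ge0 (c * s + kap * `|s|)))/le_trans; apply.
  rewrite -mulrA ler_wpM2l// -expRD.
  have [s0|s0] := leP 0 s.
    rewrite ger0_norm// ler_wpDr ?expR_ge0// ler_expR.
    by rewrite le_eqVlt; apply/orP; left; apply/eqP; ring.
  rewrite ltr0_norm// ler_wpDl ?expR_ge0// ler_expR.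
  by rewrite le_eqVlt; apply/orP; left; apply/eqP; ring.
- apply: eintegrableZ; apply: eintegrableD; apply: eintegrable_expR.
    by lra.
  by lra.
Qed.

End GammaIntegral.

(** * The remainder of the complex exponential series *)

Section ComplexExponential.
Context {R : realType}.
Implicit Types (u w z : R[i]) (s kap th : R) (N k : nat).

Lemma ReM_real (r : R) z : complex.Re (r%:C * z) = r * complex.Re z.
Proof. by case: z => a b /=; rewrite mul0r subr0. Qed.

Lemma ImM_real (r : R) z : complex.Im (r%:C * z) = r * complex.Im z.
Proof. by case: z => a b /=; rewrite mul0r addr0. Qed.

Lemma cexp0 : cexp (0 : R[i]) = 1.
Proof. by rewrite /cexp /= expR0 cos0 sin0 mul1r. Qed.

Lemma cexpD z w : cexp (z + w) = cexp z * cexp w.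
Proof.
case: z w => [a b] [c d]; rewrite /cexp /= expRD cosD sinD.
by apply/eqP; rewrite eq_complex /=; apply/andP; split; apply/eqP; ring.
Qed.

Lemma normc_cexp z : Normc.normc (cexp z) = expR (complex.Re z).
Proof.
rewrite /cexp Normc.normcM normc_real ger0_norm ?expR_ge0//.
by rewrite /= cos2Dsin2 sqrtr1 mulr1.
Qed.

(** The partial sums of the exponential series, with the real parameter [s]
    split off. *)
Definition cexp_sum N w s : R[i] := \sum_(j < N) (s ^+ j / j`!%:R)%:C * w ^+ j.

(** The remainder of the exponential series after [N] terms. *)
Definition cexp_rem N w s : R[i] := cexp (w * s%:C) - cexp_sum N w s.

Lemma is_derive_cexp u w s : is_derive s (1 : R)
  (fun t => complex.Re (u * cexp (w * t%:C)))
  (complex.Re (u * w * cexp (w * s%:C))).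
Proof.
case: u w => [a b] [x y].
have E t : complex.Re ((a +i* b) * cexp ((x +i* y) * t%:C)) =
    expR (x * t) * (a * cos (y * t) + - b * sin (y * t)).
  by rewrite /cexp /= !mulr0 subr0 !add0r; ring.
under eq_fun do rewrite E.
have dl : is_derive s (1 : R) (fun t => y * t) y.
  rewrite -[X in is_derive _ _ _ X](mulr1 y).
  by apply: is_derive_scale; exact: is_derive_id.
have dcos : is_derive s (1 : R) (fun t => cos (y * t)) (- sin (y * s) * y).
  exact: (is_derive1_comp (f := cos)).
have dsin : is_derive s (1 : R) (fun t => sin (y * t)) (cos (y * s) * y).
  exact: (is_derive1_comp (f := sin)).
have := is_derive_mul (is_derive_expR_lin x s)
  (is_derive_add (is_derive_scale a dcos) (is_derive_scale (- b) dsin)).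
move=> H; rewrite /cexp /= !mulr0 subr0 !add0r.
by apply: (is_derive_eq H); ring.
Qed.

Lemma is_derive_cexp_rem N u w s : is_derive s (1 : R)
  (fun t => complex.Re (u * cexp_rem N.+1 w t))
  (complex.Re (u * w * cexp_rem N w s)).
Proof.
have E v M t : complex.Re (v * cexp_rem M w t) =
    complex.Re (v * cexp (w * t%:C)) +
    \sum_(j < M) - (complex.Re (v * w ^+ j) / j`!%:R) * t ^+ j.
  rewrite /cexp_rem mulrBr raddfB; congr (_ + _).
  rewrite mulr_sumr raddf_sum -sumrN; apply: eq_bigr => j _.
  by rewrite /= mulrCA ReM_real; ring.
under eq_fun do rewrite E.
rewrite E; apply: is_derive_add; first exact: is_derive_cexp.
have -> : \sum_(j < N) - (complex.Re (u * w * w ^+ j) / j`!%:R) * s ^+ j =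
  \sum_(j < N.+1) - (complex.Re (u * w ^+ j) / j`!%:R) * (j%:R * s ^+ j.-1).
  rewrite big_ord_recl mul0r mulr0 add0r; apply: eq_bigr => j _ /=.
  rewrite /bump /= add1n /= factS natrM exprS mulrA; field.
  by rewrite nat1r !pnatr_eq0 /= -lt0n fact_gt0.
apply: is_derive_sum => j; apply: is_derive_scale; exact: is_derive_exprn.
Qed.

Lemma cexp_rem0 N w : cexp_rem N.+1 w 0 = 0.
Proof.
rewrite /cexp_rem /cexp_sum mulr0 cexp0 big_ord_recl big1 => [|j _].
  by rewrite !expr0 fact0 divr1 mulr1 addr0 subrr.
by rewrite exprS !mul0r.
Qed.

(** Differentiation in [s] lowers [N] by one, so induction on [N] compares the
    derivatives of the two sides; at [s = 0] the remainder vanishes. *)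
Lemma Re_cexp_rem_le N u w kap th s : 0 <= th -> Normc.normc w <= kap ->
  Normc.normc w <= th * kap -> 0 <= s ->
  complex.Re (u * cexp_rem N w s) <=
    Normc.normc u * (th ^+ N * expR (kap * s)).
Proof.
move=> th0 wk wtk; elim: N u s => [|N IH] u s s0.
  rewrite /cexp_rem /cexp_sum big_ord0 subr0 expr0 mul1r.
  apply: le_trans (ler_norm _) _; apply: le_trans (ler_Re_normc _) _.
  rewrite Normc.normcM ler_wpM2l ?normc_ge0// normc_cexp ler_expR.
  rewrite mulrC ReM_real mulrC ler_wpM2r//.
  apply: le_trans (ler_norm _) _; exact: le_trans (ler_Re_normc _) wk.
rewrite -subr_ge0.
apply: (@derive_ge0 _ (fun t => Normc.normc u * (th ^+ N.+1 * expR (kap * t))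
    - complex.Re (u * cexp_rem N.+1 w t))
  (fun t => Normc.normc u * (th ^+ N.+1 * (kap * expR (kap * t)))
    - complex.Re (u * w * cexp_rem N w t))); last exact: s0.
- move=> y; apply: is_derive_add.
    apply: is_derive_scale; apply: is_derive_scale; exact: is_derive_expR_lin.
  rewrite -mulN1r; under eq_fun do rewrite -mulN1r.
  apply: is_derive_scale; exact: is_derive_cexp_rem.
- move=> y y0; rewrite subr_ge0; apply: le_trans (IH _ _ y0) _.
  rewrite Normc.normcM exprS -!mulrA ler_wpM2l ?normc_ge0//.
  rewrite [X in _ <= _ * X]mulrCA [X in _ <= X]mulrA ler_wpM2r//.
  by rewrite mulr_ge0 ?exprn_ge0 ?expR_ge0.
- rewrite cexp_rem0 !mulr0 /= subr0 mulr_ge0 ?normc_ge0//.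
  by rewrite mulr_ge0 ?exprn_ge0 ?expR_ge0.
Qed.

(** Remainder of the exponential series. The factor [th ^+ N] comes from
    splitting off a geometric factor [|w| <= th * kap]; for [th < 1] it makes the
    remainder uniformly small against the fixed weight [exp (kap |s|)]. *)
Lemma cexp_rem_le N w kap th s : 0 <= th -> Normc.normc w <= kap ->
  Normc.normc w <= th * kap ->
  Normc.normc (cexp_rem N w s) <= th ^+ N * expR (kap * `|s|).
Proof.
move=> th0; wlog s0 : w s / 0 <= s => [main wk wtk|].
  have [s0|s0] := leP 0 s; first exact: main.
  have -> : cexp_rem N w s = cexp_rem N (- w) (- s).
    rewrite /cexp_rem /cexp_sum rmorphN mulrNN; congr (_ - _).
    apply: eq_bigr => j _; rewrite (exprNn s) (exprNn w).
    rewrite -(@signr_odd R) -(@signr_odd R[i]).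
    by case: (odd j); rewrite ?expr0 ?expr1 ?mul1r// !mulN1r mulNr rmorphN mulrNN.
  by rewrite -normrN; apply: main; rewrite ?normc_opp// oppr_ge0 ltW.
move=> wk wtk; rewrite ger0_norm//.
set z := cexp_rem N w s.
have [z0|z0] := eqVneq z 0.
  by rewrite z0 Normc.normc0 mulr_ge0 ?exprn_ge0 ?expR_ge0.
have nz : 0 < Normc.normc z by rewrite lt_neqAle normc_ge0 eq_sym normc_eq0 z0.
(* Testing against the conjugate of the remainder recovers its modulus. *)
have := @Re_cexp_rem_le N z^* w kap th s th0 wk wtk s0.
have -> : Normc.normc z^* = Normc.normc z.
  by case: (z) => a b /=; rewrite sqrrN.
have -> : complex.Re (z^* * cexp_rem N w s) = Normc.normc z * Normc.normc z.
  rewrite -/z -expr2; case: (z) => a b /=.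
  by rewrite sqr_sqrtr ?addr_ge0 ?sqr_ge0//; ring.
by rewrite ler_pM2l.
Qed.

End ComplexExponential.

(** * Complex-valued integrals *)

Section ComplexGammaIntegral.
Context {R : realType}.
Local Open Scope classical_set_scope.
Local Open Scope ring_scope.
Implicit Types (h f : R -> R[i]) (g : R -> R) (z w c : R[i]) (s : R) (k N : nat).

(** Measurability of the real and imaginary parts. *)
Definition cmeasurable h :=
  measurable_fun setT (fun s => complex.Re (h s)) /\
  measurable_fun setT (fun s => complex.Im (h s)).

Lemma cmeasurable_cst c : cmeasurable (fun=> c).
Proof. by split; exact: measurable_cst. Qed.

Lemma cmeasurable_real g : measurable_fun setT g -> cmeasurable (fun s => (g s)%:C).
Proof. by move=> mg; split => //=; exact: measurable_cst. Qed.

Lemma cmeasurableD h f : cmeasurable h -> cmeasurable f ->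
  cmeasurable (fun s => h s + f s).
Proof.
move=> [hr hi] [fr fi]; split.
  by under eq_fun do rewrite raddfD; exact: measurable_funD.
by under eq_fun do rewrite raddfD; exact: measurable_funD.
Qed.

Lemma cmeasurableM h f : cmeasurable h -> cmeasurable f ->
  cmeasurable (fun s => h s * f s).
Proof.
move=> [hr hi] [fr fi].
have ReE s : complex.Re (h s * f s) = complex.Re (h s) * complex.Re (f s) -
    complex.Im (h s) * complex.Im (f s) by case: (h s) (f s) => [? ?] [? ?].
have ImE s : complex.Im (h s * f s) = complex.Re (h s) * complex.Im (f s) +
    complex.Im (h s) * complex.Re (f s) by case: (h s) (f s) => [? ?] [? ?].
split.
  under eq_fun do rewrite ReE.
  by apply: measurable_funB; apply: measurable_funM.
under eq_fun do rewrite ImE.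
by apply: measurable_funD; apply: measurable_funM.
Qed.

Lemma cmeasurable_sum N (F : nat -> R -> R[i]) :
  (forall j, cmeasurable (F j)) -> cmeasurable (fun s => \sum_(j < N) F j s).
Proof.
move=> mF; elim: N => [|N IH].
  by under eq_fun do rewrite big_ord0; exact: cmeasurable_cst.
by under eq_fun do rewrite big_ord_recr /=; exact: cmeasurableD.
Qed.

Lemma cmeasurable_pow k (b : R) : cmeasurable (fun s => (s ^+ k / b)%:C).
Proof.
apply: cmeasurable_real; apply: measurable_funM; last exact: measurable_cst.
exact: exprn_measurable.
Qed.

Lemma cmeasurable_cexp w : cmeasurable (fun s => cexp (w * s%:C)).
Proof.
suff H u : measurable_fun setT (fun s => complex.Re (u * cexp (w * s%:C))).
  have E z : complex.Im z = complex.Re (- 'i * z) by case: z => a b /=; ring.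
  split.
    by have := H 1; under eq_fun do rewrite mul1r.
  by under eq_fun do rewrite E; exact: H.
apply: continuous_measurable_fun; apply: is_derive_continuous => s.
exact: is_derive_cexp.
Qed.

Lemma cmeasurable_cexp_rem N w : cmeasurable (cexp_rem N w).
Proof.
rewrite /cexp_rem; under eq_fun do rewrite -mulN1r.
apply: cmeasurableD; first exact: cmeasurable_cexp.
apply: cmeasurableM; first exact: cmeasurable_cst.
apply: (@cmeasurable_sum N (fun j s => (s ^+ j / j`!%:R)%:C * w ^+ j)) => j.
apply: cmeasurableM; last exact: cmeasurable_cst.
exact: cmeasurable_pow.
Qed.

(** Complex-valued analogue of [eint]. *)
Definition ecint h : R[i] :=
  eint (fun s => complex.Re (h s)) +i* eint (fun s => complex.Im (h s)).

(** Integrability of the real and imaginary parts of the integrand of [ecint]. *)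
Definition ecintegrable h :=
  eintegrable (fun s => complex.Re (h s)) /\
  eintegrable (fun s => complex.Im (h s)).

Lemma eq_ecint h f : h =1 f -> ecint h = ecint f.
Proof. by move=> /funext ->. Qed.

Lemma ecintegrable_le h g : cmeasurable h ->
  (forall s, Normc.normc (h s) <= g s) -> eintegrable g -> ecintegrable h.
Proof.
move=> [hr hi] hg ig; split; apply: (eintegrable_le _ _ ig) => // s.
  exact: le_trans (ler_Re_normc _) (hg s).
exact: le_trans (ler_Im_normc _) (hg s).
Qed.

Lemma ecintegrableD h f : ecintegrable h -> ecintegrable f ->
  ecintegrable (fun s => h s + f s).
Proof.
move=> [hr hi] [fr fi]; split.
  by under eq_fun do rewrite raddfD; exact: eintegrableD.
by under eq_fun do rewrite raddfD; exact: eintegrableD.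
Qed.

Let ReZ c h : (fun s => complex.Re (c * h s)) =
  (fun s => complex.Re c * complex.Re (h s) + - complex.Im c * complex.Im (h s)).
Proof.
by apply/funext => s; case: c (h s) => [a b] [x y] /=; rewrite mulNr.
Qed.

Let ImZ c h : (fun s => complex.Im (c * h s)) =
  (fun s => complex.Re c * complex.Im (h s) + complex.Im c * complex.Re (h s)).
Proof. by apply/funext => s; case: c (h s) => [a b] [x y]. Qed.

Lemma ecintegrableZ c h : ecintegrable h -> ecintegrable (fun s => c * h s).
Proof.
move=> [hr hi]; split.
  by rewrite ReZ; apply: eintegrableD; apply: eintegrableZ.
by rewrite ImZ; apply: eintegrableD; apply: eintegrableZ.
Qed.

Lemma ecintegrableB h f : ecintegrable h -> ecintegrable f ->
  ecintegrable (fun s => h s - f s).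
Proof.
move=> ih jf; under eq_fun do rewrite -mulN1r.
by apply: ecintegrableD => //; exact: ecintegrableZ.
Qed.

Lemma ecintD h f : ecintegrable h -> ecintegrable f ->
  ecint (fun s => h s + f s) = ecint h + ecint f.
Proof.
move=> [hr hi] [fr fi]; rewrite /ecint.
under eq_fun do rewrite raddfD.
under [X in _ +i* eint X]eq_fun do rewrite raddfD.
by rewrite !eintD.
Qed.

Lemma ecintZ c h : ecintegrable h -> ecint (fun s => c * h s) = c * ecint h.
Proof.
move=> [hr hi]; rewrite /ecint ReZ ImZ !eintD; try exact: eintegrableZ.
by rewrite !eintZ//; case: c => a b; apply/eqP; rewrite eq_complex /= mulNr !eqxx.
Qed.

Lemma ecintB h f : ecintegrable h -> ecintegrable f ->
  ecint (fun s => h s - f s) = ecint h - ecint f.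
Proof.
move=> ih jf; under eq_ecint => s do rewrite -mulN1r.
by rewrite ecintD ?ecintZ ?mulN1r//; exact: ecintegrableZ.
Qed.

Lemma ecint_sum N (F : nat -> R -> R[i]) : (forall j, ecintegrable (F j)) ->
  ecintegrable (fun s => \sum_(j < N) F j s) /\
  ecint (fun s => \sum_(j < N) F j s) = \sum_(j < N) ecint (F j).
Proof.
move=> iF; elim: N => [|N [IHi IH]].
  under eq_fun do rewrite big_ord0; rewrite big_ord0.
  have iz := ecintegrableZ 0 (iF 0); move: (ecintZ 0 (iF 0)).
  have E : (fun s => 0 * F 0%N s) = (fun=> 0) by apply/funext => s; rewrite mul0r.
  by rewrite mul0r; move: iz; rewrite E.
under eq_fun do rewrite big_ord_recr /=; rewrite big_ord_recr /=.
by split; [exact: ecintegrableD|rewrite ecintD// IH].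
Qed.

Lemma normc_ecint_le h g : ecintegrable h -> eintegrable g ->
  (forall s, Normc.normc (h s) <= g s) -> Normc.normc (ecint h) <= eint g.
Proof.
move=> ih ig hg; set z := ecint h.
have [z0|z0] := eqVneq z 0.
  rewrite z0 Normc.normc0; have := eintZ 0 ig; rewrite mul0r => <-.
  apply: eint_le => //; first exact: eintegrableZ.
  by move=> s; rewrite mul0r (le_trans _ (hg s))// normc_ge0.
have nz : 0 < Normc.normc z by rewrite lt_neqAle normc_ge0 eq_sym normc_eq0 z0.
(* Multiplication by the unimodular [u] makes the integral real and nonnegative. *)
pose u : R[i] := (Normc.normc z)^-1%:C * z^*.
have zc : z^* * z = (Normc.normc z * Normc.normc z)%:C.
  case: (z) => a b; apply/eqP; rewrite eq_complex /=.
  rewrite -[Num.sqrt _ * _]expr2 sqr_sqrtr ?addr_ge0 ?sqr_ge0//.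
  by apply/andP; split; apply/eqP; ring.
have nu : Normc.normc u = 1.
  rewrite Normc.normcM normc_real ger0_norm ?invr_ge0 ?normc_ge0//.
  have -> : Normc.normc z^* = Normc.normc z by case: (z) => a b /=; rewrite sqrrN.
  by rewrite mulVf// gt_eqF.
have uz : complex.Re (u * z) = Normc.normc z.
  by rewrite -mulrA ReM_real zc /= mulrA mulVf ?mul1r// gt_eqF.
have [iu _] := ecintegrableZ u ih.
rewrite -uz /z -ecintZ//=; apply: eint_le => // s.
apply: le_trans (ler_norm _) _; apply: le_trans (ler_Re_normc _) _.
by rewrite Normc.normcM nu mul1r.
Qed.

End ComplexGammaIntegral.

(** * Derivatives and Taylor series of the Gamma function *)

Section GammaMoments.
Context {R : realType}.
Local Open Scope classical_set_scope.
Local Open Scope ring_scope.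
Implicit Types (z w a lam : R[i]) (s kap th mu : R) (k N j : nat).

(** The integral of [exp(-t) t^(z-1) (ln t)^k]: the [k]-th derivative of Euler's
    integral, obtained by differentiating under the integral sign. *)
Definition gmoment k z : R[i] :=
  ecint (fun s => (s ^+ k)%:C * cexp ((z - 1) * s%:C)).

Lemma gmoment0 z : 0 < complex.Re z -> Gamma z = gmoment 0 z.
Proof.
move=> z0; rewrite /Gamma z0 /euler_gamma /gmoment /ecint /gamma_integrand.
congr (_ +i* _); apply: eq_Rintegral => t _.
  by rewrite ReM_real expr0 mul1r.
by rewrite ImM_real expr0 mul1r.
Qed.

Lemma normc_gmoment_integrand k z s :
  Normc.normc ((s ^+ k)%:C * cexp ((z - 1) * s%:C)) =
  ewt k (complex.Re z - 1) 0 s.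
Proof.
rewrite Normc.normcM normc_real normrX normc_cexp /ewt mul0r addr0.
by rewrite [(z - 1) * _]mulrC ReM_real raddfB /= [s * _]mulrC.
Qed.

Lemma cmeasurable_gmoment k z :
  cmeasurable (fun s => (s ^+ k)%:C * cexp ((z - 1) * s%:C)).
Proof.
apply: cmeasurableM; last exact: cmeasurable_cexp.
by apply: cmeasurable_real; exact: exprn_measurable.
Qed.

Lemma ecintegrable_gmoment k z : 0 < complex.Re z ->
  ecintegrable (fun s => (s ^+ k)%:C * cexp ((z - 1) * s%:C)).
Proof.
move=> z0; apply: (@ecintegrable_le _ _ (ewt k (complex.Re z - 1) 0)).
- exact: cmeasurable_gmoment.
- by move=> s; rewrite normc_gmoment_integrand.
- by apply: eintegrable_ewt; rewrite ?subrK.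
Qed.

(** First-order expansion of [gmoment k] with a quadratic error, from the
    remainder of the exponential series after two terms. *)
Lemma gmoment_quadratic k z : 0 < complex.Re z ->
  exists2 C : R, 0 <= C & forall h : R[i], Normc.normc h <= complex.Re z / 2 ->
  Normc.normc (gmoment k (z + h) - gmoment k z - h * gmoment k.+1 z) <=
    C * Normc.normc h ^+ 2.
Proof.
move=> z0.
have zk2 : complex.Re z = complex.Re z / 2 + complex.Re z / 2 := splitr _.
have kap0 : 0 < complex.Re z / 2 by rewrite divr_gt0.
move: (complex.Re z / 2) zk2 kap0 => kap zk2 kap0.
have kapz : kap < complex.Re z by rewrite zk2 ltrDl.
pose g := ewt k (complex.Re z - 1) kap.
have ig : eintegrable g by apply: eintegrable_ewt; rewrite ?subrK// ltW.
have ig0 : 0 <= eint g.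
  have := eintZ 0 ig; rewrite mul0r => <-; apply: eint_le => //.
    exact: eintegrableZ.
  by move=> s; rewrite mul0r ewt_ge0.
exists ((kap ^+ 2)^-1 * eint g) => [|h hk].
  by rewrite mulr_ge0// invr_ge0 exprn_ge0// ltW.
pose th := Normc.normc h / kap.
have th0 : 0 <= th by rewrite divr_ge0 ?normc_ge0// ltW.
have thk : Normc.normc h <= th * kap by rewrite divfK// gt_eqF.
have zh0 : 0 < complex.Re (z + h).
  rewrite raddfD /=; have := ler_Re_normc h; rewrite ler_norml => /andP[hl _].
  by move: kap0 hk hl; lra.
have -> : gmoment k (z + h) - gmoment k z - h * gmoment k.+1 z =
    ecint (fun s => (s ^+ k)%:C * cexp ((z - 1) * s%:C) * cexp_rem 2 h s).
  rewrite /gmoment -ecintZ; last exact: ecintegrable_gmoment.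
  rewrite -ecintB; [|exact: ecintegrable_gmoment..].
  rewrite -ecintB; last exact/ecintegrableZ/ecintegrable_gmoment.
    apply: eq_ecint => s; rewrite /cexp_rem /cexp_sum !big_ord_recr big_ord0 /=.
    rewrite -(addrA z) [h - 1]addrC addrA mulrDl cexpD.
    rewrite add0r expr0 fact0 divr1 expr1 divr1 expr1 expr0 exprS rmorphM rmorph1.
    by ring.
  by apply: ecintegrableB; exact: ecintegrable_gmoment.
have igg := eintegrableZ (th ^+ 2) ig.
have bnd s : Normc.normc ((s ^+ k)%:C * cexp ((z - 1) * s%:C) * cexp_rem 2 h s)
    <= th ^+ 2 * g s.
  rewrite Normc.normcM normc_gmoment_integrand.
  apply: le_trans (ler_wpM2l (ewt_ge0 _ _ _ _) (cexp_rem_le 2 s th0 hk thk)) _.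
  rewrite /g /ewt mul0r addr0 expRD le_eqVlt; apply/orP; left; apply/eqP; ring.
have -> : (kap ^+ 2)^-1 * eint g * Normc.normc h ^+ 2 =
    eint (fun s => th ^+ 2 * g s).
  by rewrite eintZ// /th exprMn exprVn mulrAC [_^-1 * _]mulrC.
apply: normc_ecint_le => //; apply: (ecintegrable_le _ bnd igg).
by apply: cmeasurableM; [exact: cmeasurable_gmoment|exact: cmeasurable_cexp_rem].
Qed.

(** A first-order expansion with quadratic error determines the derivative. *)
Lemma derive1_quadratic (f : R[i]^o -> R[i]^o) (z l : R[i]) (C eta : R) :
  0 < eta -> 0 <= C -> (forall h : R[i], Normc.normc h <= eta ->
    Normc.normc (f (z + h) - f z - h * l) <= C * Normc.normc h ^+ 2) ->
  derive1 f z = l.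
Proof.
move=> eta0 C0 fz; apply: cvg_lim; first exact: norm_hausdorff.
apply/cvgrPdist_lt => e e0.
have [e' e'0 ee'] : exists2 e' : R, 0 < e' & e = e'%:C.
  case: e e0 => a b; rewrite ltcE /= => /andP[/eqP b0 a0]. by exists a; rewrite // b0.
pose d : R := Num.min eta (e' / (C + 1)).
have d0 : 0 < d by rewrite lt_min eta0 divr_gt0// ltr_wpDl.
have dC0 : 0 < d%:C by rewrite ltcR.
near=> h.
have h0 : h != 0 by near: h; exact: nbhs_dnbhs_neq.
have hd : Normc.normc h < d.
  rewrite -ltcR -normc_norm; near: h.
  exact: dnbhs0_lt.
have nh : 0 < Normc.normc h by rewrite lt_neqAle normc_ge0 eq_sym normc_eq0 h0.
have -> : l - h^-1 *: (f (h + z) - f z) = - (h^-1 * (f (z + h) - f z - h * l)).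
  rewrite [h + z]addrC /GRing.scale /=.
  move: (f (z + h) - f z) => D.
  by rewrite [_ * (D - _)]mulrBr mulrA mulVf// mul1r opprB.
rewrite ee' normc_norm ltcR normc_opp Normc.normcM Normc.normcV.
rewrite ltr_pdivrMl//; apply: (le_lt_trans (fz h _)).
  by rewrite (le_trans (ltW hd))// ge_min lexx.
rewrite expr2 mulrA [_ * e']mulrC ltr_pM2r//.
apply: (@le_lt_trans _ _ (C * (e' / (C + 1)))).
  by rewrite ler_wpM2l// (le_trans (ltW hd))// ge_min lexx orbT.
by rewrite mulrA ltr_pdivrMr ?ltr_wpDl// mulrC ltr_pM2l// ltrDl.
Unshelve. all: by end_near.
Qed.

Lemma derive1n_Gamma k z : 0 < complex.Re z ->
  derive1n k (@Gamma R : R[i]^o -> R[i]^o) z = gmoment k z.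
Proof.
elim: k z => [|k IH] z z0; first exact: gmoment0.
have [C C0 zC] := gmoment_quadratic k z0.
apply: (@derive1_quadratic (derive1n k (@Gamma R : R[i]^o -> R[i]^o)) _ _ C
  (complex.Re z / 2)) => //.
  by rewrite divr_gt0.
move=> h hz; rewrite IH ?IH ?zC//.
rewrite raddfD /=; have := ler_Re_normc h; rewrite ler_norml => /andP[hl _].
by move: hz hl; lra.
Qed.

(** Taylor coefficients of the Gamma function at [lam]. *)
Definition gcoef lam j : R[i] :=
  ecint (fun s => (s ^+ j / j`!%:R)%:C * cexp ((lam - 1) * s%:C)).

Lemma normc_gcoef_integrand lam j s :
  Normc.normc ((s ^+ j / j`!%:R)%:C * cexp ((lam - 1) * s%:C)) =
  (j`!%:R)^-1 * ewt j (complex.Re lam - 1) 0 s.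
Proof.
rewrite -normc_gmoment_integrand !Normc.normcM !normc_real normrM.
by rewrite [`|_^-1|]ger0_norm ?invr_ge0// mulrAC mulrC.
Qed.

Lemma ecintegrable_gcoef lam j : 0 < complex.Re lam ->
  ecintegrable (fun s => (s ^+ j / j`!%:R)%:C * cexp ((lam - 1) * s%:C)).
Proof.
move=> l0; apply: (@ecintegrable_le _ _
  (fun s => (j`!%:R)^-1 * ewt j (complex.Re lam - 1) 0 s)).
- by apply: cmeasurableM; [exact: cmeasurable_pow|exact: cmeasurable_cexp].
- by move=> s; rewrite normc_gcoef_integrand.
- by apply: eintegrableZ; apply: eintegrable_ewt; rewrite ?subrK.
Qed.

Lemma normc_gcoef_le lam j : 0 < complex.Re lam ->
  Normc.normc (gcoef lam j) <=
    eint (fun s => (j`!%:R)^-1 * ewt j (complex.Re lam - 1) 0 s).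
Proof.
move=> l0; apply: normc_ecint_le; first exact: ecintegrable_gcoef.
  by apply: eintegrableZ; apply: eintegrable_ewt; rewrite ?subrK.
by move=> s; rewrite normc_gcoef_integrand.
Qed.

(** The left-hand side is the sum, over the terms of the exponential series, of
    their [k]-th derivatives in [w]. *)
Lemma cexp_sum_derivn k N w s :
  \sum_(j < N) (s ^+ j / j`!%:R)%:C * (w ^+ (j - k) *+ j ^_ k) =
  (s ^+ k)%:C * cexp_sum (N - k) w s.
Proof.
pose F j : R[i] := (s ^+ j / j`!%:R)%:C * (w ^+ (j - k) *+ j ^_ k).
have F0 j : (j < k)%N -> F j = 0.
  by move=> jk; rewrite /F ffact_small// mulr0n mulr0.
rewrite -/(F _) -(big_mkord xpredT F) /cexp_sum.
have [kN|Nk] := leqP k N; last first.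
  rewrite (_ : (N - k)%N = 0%N) ?big_ord0 ?mulr0; last first.
    by apply/eqP; rewrite subn_eq0 ltnW.
  rewrite big_mkord big1// => j _; apply: F0.
  exact: ltn_trans (ltn_ord j) Nk.
rewrite (big_cat_nat (leq0n k) kN)/= [X in X + _]big_mkord big1 ?add0r; last first.
  by move=> j _; exact: F0.
rewrite -{1}[k]add0n big_addn big_mkord mulr_sumr; apply: eq_bigr => j _.
rewrite /F addnK -[w ^+ j *+ _]mulr_natr.
have -> : ((j + k) ^_ k)%:R = ((j + k) ^_ k)%:R%:C :> R[i] by rewrite rmorph_nat.
rewrite [w ^+ j * _]mulrC !mulrA -!rmorphM; congr (_%:C * _).
rewrite -(ffact_fact (leq_addl j k)) addnK natrM exprD; field.
by rewrite !pnatr_eq0 -!lt0n fact_gt0 ffact_gt0 leq_addl.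
Qed.

(** The Taylor series of Gamma at [lam] and all its formal derivatives converge
    to the derivatives of Gamma, at a geometric rate when [th < 1]. *)
Lemma gmoment_taylor k N lam a kap th : 0 <= th ->
  Normc.normc (a - lam) <= kap -> Normc.normc (a - lam) <= th * kap ->
  kap < complex.Re lam ->
  Normc.normc (gmoment k a -
    \sum_(j < N) gcoef lam j * ((a - lam) ^+ (j - k) *+ j ^_ k)) <=
  th ^+ (N - k) * eint (ewt k (complex.Re lam - 1) kap).
Proof.
move=> th0 ak atk kl; set w := a - lam.
have kap0 : 0 <= kap := le_trans (normc_ge0 _) ak.
have l0 : 0 < complex.Re lam := le_lt_trans kap0 kl.
have a0 : 0 < complex.Re a.
  have -> : complex.Re a = complex.Re lam + complex.Re w.
    by rewrite -raddfD /= /w addrC subrK.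
  have := ler_Re_normc w; rewrite ler_norml => /andP[hl _].
  by move: ak kl hl; rewrite -/w; lra.
pose g := ewt k (complex.Re lam - 1) kap.
have ig : eintegrable g by apply: eintegrable_ewt; rewrite ?subrK.
pose F j s : R[i] := (w ^+ (j - k) *+ j ^_ k) *
  ((s ^+ j / j`!%:R)%:C * cexp ((lam - 1) * s%:C)).
have iF j : ecintegrable (F j) by apply: ecintegrableZ; exact: ecintegrable_gcoef.
have [iS ES] := ecint_sum N iF.
have -> : \sum_(j < N) gcoef lam j * (w ^+ (j - k) *+ j ^_ k) =
    \sum_(j < N) ecint (F j).
  apply: eq_bigr => j _; rewrite ecintZ; last exact: ecintegrable_gcoef.
  by rewrite mulrC.
rewrite -ES /gmoment -ecintB//; last exact: ecintegrable_gmoment.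
have -> : ecint (fun s => (s ^+ k)%:C * cexp ((a - 1) * s%:C)
      - \sum_(j < N) F j s) =
    ecint (fun s => (s ^+ k)%:C * cexp ((lam - 1) * s%:C) * cexp_rem (N - k) w s).
  apply: eq_ecint => s.
  have -> : \sum_(j < N) F j s = cexp ((lam - 1) * s%:C) *
      \sum_(j < N) (s ^+ j / j`!%:R)%:C * (w ^+ (j - k) *+ j ^_ k).
    by rewrite mulr_sumr; apply: eq_bigr => j _; rewrite /F; ring.
  rewrite cexp_sum_derivn /cexp_rem.
  have -> : (a - 1) * s%:C = (lam - 1) * s%:C + w * s%:C by rewrite /w; ring.
  by rewrite cexpD; ring.
have igg := eintegrableZ (th ^+ (N - k)) ig.
have bnd s : Normc.normc ((s ^+ k)%:C * cexp ((lam - 1) * s%:C) *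
    cexp_rem (N - k) w s) <= th ^+ (N - k) * g s.
  rewrite Normc.normcM normc_gmoment_integrand.
  apply: le_trans (ler_wpM2l (ewt_ge0 _ _ _ _) (cexp_rem_le _ s th0 ak atk)) _.
  rewrite /g /ewt mul0r addr0 expRD le_eqVlt; apply/orP; left; apply/eqP; ring.
rewrite -eintZ//; apply: normc_ecint_le => //; apply: (ecintegrable_le _ bnd igg).
by apply: cmeasurableM; [exact: cmeasurable_gmoment|exact: cmeasurable_cexp_rem].
Qed.

Lemma eint_sum N (g : nat -> R -> R) : (forall j, eintegrable (g j)) ->
  eintegrable (fun s => \sum_(j < N) g j s) /\
  eint (fun s => \sum_(j < N) g j s) = \sum_(j < N) eint (g j).
Proof.
move=> ig; elim: N => [|N [IHi IH]].
  under eq_fun do rewrite big_ord0; rewrite big_ord0.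
  have iz := eintegrableZ 0 (ig 0); move: (eintZ 0 (ig 0)).
  have E : (fun s => 0 * g 0%N s) = (fun=> 0) by apply/funext => s; rewrite mul0r.
  by rewrite mul0r; move: iz; rewrite E.
under eq_fun do rewrite big_ord_recr /=; rewrite big_ord_recr /=.
by split; [exact: eintegrableD|rewrite eintD// IH].
Qed.

(** Summing under the integral sign, [sum_j |s|^j / j! * j mu^(j-1)] is bounded by
    [|s| exp(mu |s|)]. *)
Lemma gcoef_derive_sum_le lam mu N : 0 <= mu -> mu < complex.Re lam ->
  \sum_(j < N) Normc.normc (gcoef lam j) * (j%:R * mu ^+ j.-1) <=
  eint (ewt 1 (complex.Re lam - 1) mu).
Proof.
move=> mu0 mul; have l0 := le_lt_trans mu0 mul.
pose g j s := (j%:R * mu ^+ j.-1) * ((j`!%:R)^-1 * ewt j (complex.Re lam - 1) 0 s).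
have ig0 j : eintegrable (fun s => (j`!%:R)^-1 * ewt j (complex.Re lam - 1) 0 s).
  by apply: eintegrableZ; apply: eintegrable_ewt; rewrite ?subrK.
have ig j : eintegrable (g j) by exact: eintegrableZ.
have [iS ES] := eint_sum N ig.
apply: (@le_trans _ _ (\sum_(j < N) eint (g j))).
  apply: ler_sum => j _; rewrite eintZ// mulrC ler_wpM2l ?normc_gcoef_le//.
  by rewrite mulr_ge0// exprn_ge0.
rewrite -ES; apply: eint_le => //; first by apply: eintegrable_ewt; rewrite ?subrK.
move=> s; rewrite /ewt expr1 expRD mulrA [leRHS]mulrC.
case: N {iS ES} => [|N].
  by rewrite big_ord0 mulr_ge0 ?mulr_ge0 ?expR_ge0.
apply: le_trans (ler_wpM2r _ (powerseries_le_expR N (mulr_ge0 mu0 (normr_ge0 s)))).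
  rewrite big_ord_recl /g mul0r mul0r add0r mulr_suml.
  apply: ler_sum => j _; rewrite lift0 /= /ewt mul0r addr0.
  rewrite le_eqVlt; apply/orP; left; apply/eqP.
  rewrite factS natrM exprMn exprS; field.
  by rewrite nat1r !pnatr_eq0 /= -lt0n fact_gt0.
by rewrite mulr_ge0 ?expR_ge0.
Qed.

End GammaMoments.

(** * The scalar estimate *)

Section ScalarBound.
Context {R : realType}.
Local Open Scope classical_set_scope.
Local Open Scope ring_scope.
Notation lmu := (@lebesgue_measure R).
Implicit Types (c s t x mu : R).

(** In the variable [t = exp s] this is [- t^(c-1) ln t] restricted to [t < 1]. *)
Definition logneg c s : R := Num.max (- s) 0 * expR ((c - 1) * s).

Lemma logneg_ge0 c s : 0 <= logneg c s.
Proof. by rewrite mulr_ge0 ?expR_ge0// le_max lexx orbT. Qed.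

Lemma measurable_logneg c : measurable_fun setT (logneg c).
Proof.
apply: (@measurable_funM _ _ _ _ (fun s => Num.max (- s) 0)
  (fun s => expR ((c - 1) * s))).
  apply: measurable_funrpos; exact: oppr_measurable.
apply: continuous_measurable_fun; exact: continuous_expR_lin.
Qed.

Lemma eintegrable_logneg c : 0 < c -> eintegrable (logneg c).
Proof.
move=> c0; apply: (@eintegrable_le _ _ (ewt 1 (c - 1) 0)).
- exact: measurable_logneg.
- move=> s; rewrite ger0_norm ?logneg_ge0// /ewt expr1 mul0r addr0.
  by rewrite ler_wpM2r ?expR_ge0// ge_max normr_ge0 -normrN ler_norm.
- by apply: eintegrable_ewt; rewrite ?subrK.
Qed.

(** An antiderivative of [- s exp (c s)]. *)
Definition lnprim c s : R := (c ^+ 2)^-1 * (expR (c * s) * (1 - c * s)).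

Lemma is_derive_lnprim c s : c != 0 ->
  is_derive s (1 : R) (lnprim c) (- s * expR (c * s)).
Proof.
move=> c0.
have d1 : is_derive s (1 : R) (fun t => 1 + - c * t) (0 + - c * 1).
  apply: is_derive_add; apply: is_derive_scale; exact: is_derive_id.
have := is_derive_scale (c ^+ 2)^-1 (is_derive_mul (is_derive_expR_lin c s) d1).
rewrite /lnprim; under [X in _ -> is_derive _ _ X _]eq_fun do rewrite -mulNr.
by move=> H; apply: (is_derive_eq H); field.
Qed.

Lemma lnprim_ge0 c s : 0 < c -> s <= 0 -> 0 <= lnprim c s.
Proof.
move=> c0 s0; rewrite mulr_ge0 ?invr_ge0 ?exprn_ge0 ?(ltW c0)// mulr_ge0 ?expR_ge0//.
by rewrite subr_ge0 (le_trans _ (@ler01 R))// pmulr_rle0.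
Qed.

(** In the variable [t], [lnprim c] is the integral of [- u^(c-1) ln u] over
    [0 < u < t], hence decreasing in [c] for [t <= 1]. *)
Lemma lnprim_decr c s : 0 < c -> s <= 0 -> lnprim (c + 1) s <= lnprim c s.
Proof.
move=> c0 s0; have c10 : 0 < c + 1 by rewrite addr_gt0.
have E a : a != 0 -> lnprim a s = expR (a * s) * ((a ^+ 2)^-1 + - s * a^-1).
  by move=> a0; rewrite /lnprim; field.
rewrite !E ?gt_eqF//; apply: ler_pM; rewrite ?expR_ge0//.
- rewrite addr_ge0 ?invr_ge0 ?exprn_ge0 ?(ltW c10)//.
  by rewrite mulr_ge0 ?oppr_ge0// invr_ge0 ltW.
- by rewrite ler_expR mulrDl mul1r gerDl.
- apply: lerD.
    rewrite lef_pV2 ?posrE ?exprn_gt0// lerXn2r ?nnegrE ?(ltW c0) ?(ltW c10)//.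
    by rewrite lerDl.
  by rewrite ler_wpM2l ?oppr_ge0// lef_pV2 ?posrE// lerDl.
Qed.

Lemma eint_logneg_lt c : 0 < c -> eint (logneg c) < omega c.
Proof.
move=> c0; have c1 : 0 < c + 1 by rewrite addr_gt0.
have c2 : 0 < c + 2 by rewrite addr_gt0.
(* [gam (ln t) / t] is [- t^(c-1) ln t] times [1 - t + t^2/2], a bound of [exp(-t)]. *)
pose gam s : R := - s * expR (c * s) + -1 * (- s * expR ((c + 1) * s))
  + 2^-1 * (- s * expR ((c + 2) * s)).
pose G s : R := lnprim c s + -1 * lnprim (c + 1) s + 2^-1 * lnprim (c + 2) s.
have dG s : is_derive s (1 : R) G (gam s).
  apply: is_derive_add.
    apply: is_derive_add; first by apply: is_derive_lnprim; rewrite gt_eqF.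
    by apply: is_derive_scale; apply: is_derive_lnprim; rewrite gt_eqF.
  by apply: is_derive_scale; apply: is_derive_lnprim; rewrite gt_eqF.
have cg a : continuous (fun s : R => - s * expR (a * s)).
  move=> s; apply: cvgM; first by apply: cvgN; exact: cvg_id.
  exact: continuous_expR_lin.
have cgam : continuous gam.
  move=> s; apply: cvgD; first apply: cvgD; first exact: cg.
    by apply: cvgMr; exact: cg.
  by apply: cvgMr; exact: cg.
have gamE t : 0 < t ->
    gam (ln t) * expR (- ln t) =
    (1 - t + t ^+ 2 / 2) * (- ln t * expR ((c - 1) * ln t)).
  move=> t0; have tE : t = expR (ln t) by rewrite lnK.
  have -> : expR (- ln t) = t^-1 by rewrite expRN -tE.
  have -> : expR ((c - 1) * ln t) = expR (c * ln t) * t^-1.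
    by rewrite mulrBl mul1r expRD expRN -tE.
  have e1 : expR ((c + 1) * ln t) = expR (c * ln t) * t.
    by rewrite mulrDl mul1r expRD -tE.
  have e2 : expR ((c + 2) * ln t) = expR (c * ln t) * t ^+ 2.
    by rewrite mulrDl expRD expRM_natl -tE.
  by rewrite /gam e1 e2; field; rewrite gt_eqF.
have gam0 s : s <= 0 -> 0 <= gam s.
  move=> s0; have := gamE (expR s) (expR_gt0 s); rewrite expRK => gE.
  rewrite -(pmulr_lge0 _ (expR_gt0 (- s))) gE mulr_ge0//.
    have e0 := expR_ge0 s.
    have : expR s <= 1 by rewrite expR_le1.
    by move=> e1; rewrite addr_ge0 ?subr_ge0// divr_ge0 ?exprn_ge0.
  by rewrite mulr_ge0 ?expR_ge0// oppr_ge0.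
have G0 : G 0 = (c ^+ 2)^-1 - ((c + 1) ^+ 2)^-1 + 2^-1 * ((c + 2) ^+ 2)^-1.
  by rewrite /G /lnprim !mulr0 expR0 subr0 !mulr1 mulN1r.
have bnd : (\int[lmu]_(t in `]0%R, 1%R]) (gam (ln t) * expR (- ln t))%:E
    <= (G 0)%:E)%E.
  apply: (@integral_ln_le _ gam G (fun n => - n.+1%:R) (fun n => 0)) => //.
  - by move=> m n mn; rewrite lerN2 ler_nat.
  - rewrite eqEsubset; split=> t; rewrite /= in_itv /=.
      move=> /andP[t0 t1]; exists (Num.truncn `|ln t|) => //=.
      rewrite in_itv /= expR0 t1 andbT -{2}(@lnK _ t)// ler_expR.
      have : `|ln t| <= (Num.truncn `|ln t|).+1%:R by rewrite ltW// truncnS_gt.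
      by rewrite ler_norml => /andP[].
    move=> [n _]; rewrite /= in_itv /= expR0 => /andP[+ ->]; rewrite andbT.
    by apply: lt_le_trans; rewrite expR_gt0.
  - by move=> n s /andP[_]; exact: gam0.
  - move=> n; have n0 : - n.+1%:R <= 0 :> R by rewrite oppr_le0.
    have := lnprim_decr c0 n0; have := lnprim_ge0 c2 n0.
    move=> l2 l1; rewrite gerBl /G mulN1r addr_ge0 ?subr_ge0//.
    by rewrite mulr_ge0 ?invr_ge0.
have le : eint (logneg c) <= G 0.
  have il := eintegrable_logneg c0.
  have fin := integrable_fin_num _ il.
  rewrite -lee_fin /eint /Rintegral fineK; last first.
    by apply: fin; exact: measurable_itv.
  have -> : [set` `]0%R, +oo[] =
      [set` `]0%R, 1%R]] `|` [set` `]1%R, +oo[] :> set R.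
    by rewrite -itv_bndbnd_setU ?bnd_simp.
  have mf : measurable_fun setT (fun t => (expR (- t) * logneg c (ln t))%:E).
    apply/measurable_EFinP; apply: (@emeasurable R setT (logneg c)).
    exact: measurable_logneg.
  have pos t : (0 <= (expR (- t) * logneg c (ln t))%:E)%E.
    by rewrite lee_fin mulr_ge0 ?expR_ge0 ?logneg_ge0.
  rewrite ge0_integral_setU//=.
  - rewrite [X in (_ + X)%E]integral0_eq ?adde0; last first.
      move=> t; rewrite /= in_itv /= andbT => t1.
      rewrite /logneg max_r ?mul0r ?mulr0// oppr_le0 ltW// ln_gt0//.
    apply: le_trans bnd; apply: ge0_le_integral => //.
    + exact: measurable_funTS.
    + apply/measurable_EFinP; apply: measurable_funTS; apply: measurable_funM.
        apply: measurableT_comp; last exact: measurable_ln.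
        exact: continuous_measurable_fun.
      apply: measurableT_comp => //; apply: measurableT_comp.
        exact: oppr_measurable.
      exact: measurable_ln.
    + move=> t; rewrite /= in_itv /= => /andP[t0 t1].
      rewrite lee_fin gamE// /logneg max_l ?oppr_ge0 ?ln_le0//.
      rewrite ler_wpM2r ?expRN_le ?(ltW t0)//.
      by rewrite mulr_ge0 ?expR_ge0// oppr_ge0 ln_le0.
  - exact: measurable_funTS.
  - apply/disj_setPS => t [/=]; rewrite !in_itv /= andbT => /andP[_ t1].
    by rewrite ltNge t1.
apply: le_lt_trans le _; rewrite G0 /omega.
have -> : (2 * c + 1) / (c ^+ 2 * (c + 1) ^+ 2) =
    (c ^+ 2)^-1 - ((c + 1) ^+ 2)^-1 by field; rewrite !gt_eqF.
rewrite ltrD2l ltr_pM2r ?invr_gt0 ?exprn_gt0//.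
by have := @cosh1_gt R; rewrite div1r.
Qed.

Lemma cexp_real x : cexp x%:C = (expR x)%:C.
Proof. by rewrite /cexp /= cos0 sin0 mulr1. Qed.

Lemma Gamma1E x : 0 < x -> Gamma1 x = eint (fun s => s * expR ((x - 1) * s)).
Proof.
move=> x0; rewrite /Gamma1 /Gamma_derive derive1n_Gamma// /gmoment /ecint /eint.
apply: eq_Rintegral => t _.
have -> : x%:C - 1 = (x - 1)%:C by rewrite rmorphB rmorph1.
by rewrite -rmorphM cexp_real -rmorphM expr1.
Qed.

(** For [s < 0] the term [s exp((x + mu - 1) s)] of the integrand of Gamma' is
    cancelled by [logneg (x + mu)]. *)
Lemma eint_ewt1_lt x mu : 0 <= mu -> mu < x ->
  eint (ewt 1 (x - 1) mu) < Gamma1 (x + mu) + omega (x + mu) + omega (x - mu).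
Proof.
move=> mu0 mux; have x0 := le_lt_trans mu0 mux.
have a0 : 0 < x + mu by rewrite ltr_wpDr.
have b0 : 0 < x - mu by rewrite subr_gt0.
have igam : eintegrable (fun s => s * expR ((x + mu - 1) * s)).
  apply: (@eintegrable_le _ _ (ewt 1 (x + mu - 1) 0)).
  - apply: measurable_funM => //.
    apply: continuous_measurable_fun; exact: continuous_expR_lin.
  - move=> s; rewrite normrM [`|expR _|]ger0_norm ?expR_ge0//.
    by rewrite /ewt expr1 mul0r addr0.
  - by apply: eintegrable_ewt; rewrite ?subrK.
have -> : ewt 1 (x - 1) mu = fun s => s * expR ((x + mu - 1) * s) +
    logneg (x + mu) s + logneg (x - mu) s.
  apply/funext => s; rewrite /ewt /logneg expr1.
  have [s0|s0] := leP 0 s.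
    rewrite ger0_norm// max_r ?oppr_le0// !mul0r !addr0.
    by congr (_ * expR _); ring.
  rewrite ltr0_norm// max_l ?oppr_ge0 ?ltW//.
  rewrite [- s * expR ((x + mu - 1) * s)]mulNr addrN add0r.
  by congr (_ * expR _); ring.
rewrite !eintD//; try exact: eintegrable_logneg.
  by rewrite -Gamma1E// ltrD ?ltrD2l ?eint_logneg_lt.
by apply: eintegrableD => //; exact: eintegrable_logneg.
Qed.

End ScalarBound.

(** * The matrix Gamma function *)

Section GammaMatrix.
Context {R : realType} {p : exponent}.
Hypothesis p_ok : valid_exponent p.

Lemma derivn_XsubC_exp (F : comNzRingType) (c a : F) (j k : nat) :
  (('X - c%:P) ^+ j)^`(k).[a] = (a - c) ^+ (j - k) *+ j ^_ k.
Proof.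
have -> : (('X - c%:P) ^+ j)^`(k) = ('X - c%:P) ^+ (j - k) *+ j ^_ k.
  elim: k => [|k IH]; first by rewrite derivn0 subn0 ffactn0 mulr1n.
  rewrite derivnS IH derivMn deriv_exp derivXsubC mul1r -subnS -mulrnA.
  by rewrite ffactnSr mulnC.
by rewrite hornerMn horner_exp !hornerE.
Qed.

Lemma char_poly_tr (F : comNzRingType) n (A : 'M[F]_n) :
  char_poly A^T = char_poly A.
Proof.
rewrite /char_poly -det_tr; congr (\det _); apply/matrixP => i j.
by rewrite !mxE eq_sym.
Qed.

(** The eigenvalues of [A] lie within [|A - lam|] of [lam]. *)
Lemma root_mxminpoly_normc n (A : 'M[R[i]]_n.+1) (lam a : R[i]) :
  root (mxminpoly A) a -> Normc.normc (a - lam) <= opnorm p (A - lam%:M).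
Proof.
rewrite root_mxminpoly -char_poly_tr -eigenvalue_root_char.
(* Passing to the transpose yields a column eigenvector of [A]. *)
move=> /eigenvalueP[v /(congr1 trmx)]; rewrite trmx_mul trmxK linearZ /= => Av v0.
have vt0 : v^T != 0.
  by apply: contra v0 => /eqP/(congr1 trmx); rewrite trmxK trmx0 => ->.
have := vnorm_mulmx p_ok (A - lam%:M) v^T.
rewrite mulmxBl Av mul_scalar_mx -scalerBl vnormZ//.
by rewrite ler_pM2r ?vnorm_gt0.
Qed.

Lemma exprmx_iter n (X : 'M[R[i]]_n.+1) j : X ^+ j = iter j (mulmx X) 1%:M.
Proof. by elim: j => //= j <-; rewrite exprS. Qed.

Lemma hermite_interpolates_exists n (f : R[i]^o -> R[i]^o) (A : 'M[R[i]]_n.+1) :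
  exists r, hermite_interpolates f A r.
Proof.
have [s sE] := closed_field_poly_normal (mxminpoly A).
have [r rE] := hermite_exists (@pchar_num _) s (fun a k => derive1n k f a).
exists r => a k ak; apply: rE.
by rewrite -mu_prod_XsubC -[X in mup a X]scale1r -(monicP (mxminpoly_monic A)) -sE.
Qed.

(** The primary matrix function Gamma is the sum of its Taylor series at [lam]:
    by Newton's form of Hermite interpolation, the error is controlled by finitely
    many jets, each converging at the rate of [gmoment_taylor]. *)
Lemma Gamma_mx_taylor n (X : 'M[R[i]]_n.+1) (lam : R[i]) (mu : R) :
  opnorm p X <= mu -> mu < complex.Re lam ->
  exists2 err : nat -> R, (err N @[N --> \oo] --> 0)%classic & forall N,
    opnorm p (Gamma_mx (lam%:M + X) - \sum_(j < N) gcoef lam j *: X ^+ j) <= err N.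
Proof.
move=> Xmu mul; set A := lam%:M + X.
have mu0 : 0 <= mu := le_trans (opnorm_ge0 p_ok _) Xmu.
have l0 := le_lt_trans mu0 mul.
(* The ratio [th < 1] is gained from a radius [kap] between [mu] and [Re lam]. *)
pose kap := (mu + complex.Re lam) / 2; pose th := mu / kap.
have kap0 : 0 < kap by rewrite divr_gt0// ltr_wpDl.
have kapl : kap < complex.Re lam by rewrite ltr_pdivrMr// mulr_natr mulr2n ltrD2r.
have muk : mu < kap by rewrite ltr_pdivlMr// mulr_natr mulr2n ltrD2l.
have th0 : 0 <= th by rewrite divr_ge0// ltW.
have th1 : th < 1 by rewrite ltr_pdivrMr// mul1r.
have thk : th * kap = mu by rewrite divfK// gt_eqF.
have [s sE] := closed_field_poly_normal (mxminpoly A).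
rewrite (monicP (mxminpoly_monic A)) scale1r in sE.
have [L [Lok LP]] := hermite_newton (@pchar_num _) s.
pose r := xget 0 [set r | hermite_interpolates (@Gamma R) A r]%classic.
have rE : hermite_interpolates (@Gamma R) A r.
  exact: (xgetPex 0 (hermite_interpolates_exists (@Gamma R) A)).
pose H (t : R[i] * nat * {poly R[i]}) := horner_mx A t.2.
exists (fun N => \sum_(t <- L) th ^+ (N - t.1.2) *
    (eint (ewt t.1.2 (complex.Re lam - 1) kap) * opnorm p (H t))).
  elim: L {Lok LP} => [|t L IH].
    by under eq_fun do rewrite big_nil; exact: cvg_cst.
  under eq_fun do rewrite big_cons.
  set K := eint _ * _.
  have cK : (th ^+ (N - t.1.2) * K @[N --> \oo] --> 0 * K)%classic.
    apply: cvgMl; rewrite -(cvg_shiftn t.1.2).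
    under eq_fun do rewrite addnK.
    by apply: cvg_expr; rewrite ger0_norm.
  by have := cvgD cK IH; rewrite mul0r addr0; exact.
move=> N; pose q := r - \sum_(j < N) gcoef lam j *: ('X - lam%:P) ^+ j.
have qA : Gamma_mx A - \sum_(j < N) gcoef lam j *: X ^+ j = horner_mx A q.
  rewrite /q rmorphB rmorph_sum; congr (_ - _); apply: eq_bigr => j _.
  rewrite -mul_polyC rmorphM rmorphXn rmorphB /= horner_mx_X !horner_mx_C.
  by rewrite /A addrC addKr -mul_scalar_mx.
have qL : horner_mx A q = \sum_(t <- L) q^`(t.1.2).[t.1.1] *: H t.
  have /mxminpoly_minP : mxminpoly A %| q - \sum_(t <- L) q^`(t.1.2).[t.1.1] *: t.2.
    by rewrite sE.
  move=> /eqP; rewrite rmorphB subr_eq0 => /eqP ->.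
  rewrite rmorph_sum; apply: eq_bigr => t _.
  by rewrite -mul_polyC rmorphM /= horner_mx_C -mul_scalar_mx.
rewrite qA qL; apply: le_trans (opnorm_sum p_ok _ _ _) _.
rewrite big_seq [leRHS]big_seq; apply: ler_sum => t tL.
apply: le_trans (opnormZ p_ok _ _) _.
rewrite mulrA ler_wpM2r ?opnorm_ge0//.
have tk := allP Lok t tL.
have ta : root (mxminpoly A) t.1.1.
  rewrite sE root_prod_XsubC -has_pred1 has_count.
  exact: leq_ltn_trans tk.
have tmu : Normc.normc (t.1.1 - lam) <= mu.
  apply: le_trans (root_mxminpoly_normc lam ta) _.
  by rewrite /A addrC addKr.
have -> : q^`(t.1.2).[t.1.1] = gmoment t.1.2 t.1.1 -
    \sum_(j < N) gcoef lam j * ((t.1.1 - lam) ^+ (j - t.1.2) *+ j ^_ t.1.2).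
  rewrite /q derivnB hornerD hornerN; congr (_ - _).
    rewrite rE; last by rewrite sE mu_prod_XsubC.
    apply: derive1n_Gamma.
    have := ler_Re_normc (t.1.1 - lam); rewrite ler_norml => /andP[hl _].
    rewrite -(subrK lam t.1.1) raddfD /=.
    by move: hl tmu mul; lra.
  have -> : (\sum_(j < N) gcoef lam j *: ('X - lam%:P) ^+ j)^`(t.1.2) =
     \sum_(j < N) gcoef lam j *: (('X - lam%:P) ^+ j)^`(t.1.2).
    by rewrite raddf_sum; apply: eq_bigr => j _; exact: derivnZ.
  rewrite horner_sum; apply: eq_bigr => j _.
  by rewrite hornerZ derivn_XsubC_exp.
apply: gmoment_taylor => //; first exact: le_trans tmu (ltW muk).
by rewrite thk.
Qed.

Lemma opnormN n (A : 'M[R[i]]_n) : opnorm p (- A) <= opnorm p A.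
Proof.
by rewrite -scaleN1r (le_trans (opnormZ p_ok _ _))// normc_opp Normc.normc1 mul1r.
Qed.

(** The partial sums of the two Taylor series satisfy the bound by the telescoping
    estimate; it passes to the limit. *)
Lemma Gamma_mx_perturbation n (X Y : 'M[R[i]]_n.+1) (lam : R[i]) (mu e : R) :
  opnorm p X <= mu -> opnorm p Y <= mu -> opnorm p (X - Y) <= e ->
  mu < complex.Re lam ->
  opnorm p (Gamma_mx (lam%:M + X) - Gamma_mx (lam%:M + Y)) <=
    e * eint (ewt 1 (complex.Re lam - 1) mu).
Proof.
move=> Xmu Ymu XYe mul.
have mu0 : 0 <= mu := le_trans (opnorm_ge0 p_ok _) Xmu.
have e0 : 0 <= e := le_trans (opnorm_ge0 p_ok _) XYe.
have [ex ex0 exP] := Gamma_mx_taylor Xmu mul.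
have [ey ey0 eyP] := Gamma_mx_taylor Ymu mul.
set J := e * _; set D := opnorm p _.
have cv : (ex N + ey N + J @[N --> \oo] --> J)%classic.
  by have := cvgD (cvgD ex0 ey0) (cvg_cst J); rewrite addr0 add0r; apply.
rewrite -[leRHS](cvg_lim _ cv)//; apply: limr_ge; first exact: cvgP cv.
apply: nearW => N.
pose SX := \sum_(j < N) gcoef lam j *: X ^+ j.
pose SY := \sum_(j < N) gcoef lam j *: Y ^+ j.
rewrite /D; set GX := Gamma_mx _; set GY := Gamma_mx _.
have split4 (a b c d : 'M[R[i]]_n.+1) : a - b = (a - c) + - (b - d) + (c - d).
  rewrite opprB [RHS]addrC addrA [c - d + _]addrC [a - c + _]addrA.
  by rewrite subrK addrA subrK.
rewrite (split4 GX GY SX SY).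
apply: le_trans (opnormD p_ok _ _) _; apply: lerD.
  apply: le_trans (opnormD p_ok _ _) _; apply: lerD; first exact: exP.
  exact: le_trans (opnormN _) (eyP N).
rewrite /SX /SY -sumrB; apply: le_trans (opnorm_sum p_ok _ _ _) _.
apply: (@le_trans _ _ (e * \sum_(j < N) Normc.normc (gcoef lam j) *
    (j%:R * mu ^+ j.-1))); last first.
  by rewrite ler_wpM2l// gcoef_derive_sum_le.
rewrite mulr_sumr; apply: ler_sum => j _; rewrite -scalerBr.
apply: le_trans (opnormZ p_ok _ _) _.
rewrite [leRHS]mulrCA ler_wpM2l ?normc_ge0// !exprmx_iter.
exact: opnorm_exp_sub.
Qed.

End GammaMatrix.

(** The perturbation bound for an arbitrary nonnegative matrix [M]. *)
Lemma Gamma_mx_perturbation_lt (R : realType) (p : exponent) (m : nat)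
    (lam : R[i]) (M Rj : 'M[R]_m) (Q : 'M[R[i]]_m) :
  valid_exponent p -> (forall i k, 0 <= M i k) -> (forall i k, 0 <= Rj i k) ->
  Rj != 0 -> 0 < complex.Re lam - opnorm p (cplx_mx (M + Rj)) ->
  (forall i k, Normc.normc (Q i k) <= Rj i k) ->
  opnorm p (Gamma_mx (lam%:M + cplx_mx M + Q) - Gamma_mx (lam%:M + cplx_mx M))
    < delta p lam M Rj.
Proof.
move=> p_ok M0 R0 Rn0; rewrite subr_gt0 => mul QR.
case: m M Rj Q M0 R0 Rn0 mul QR => [|m] M Rj Q M0 R0 Rn0 mul QR.
  by case/eqP: Rn0; apply/matrixP => -[].
set mu := opnorm p (cplx_mx (M + Rj)) in mul *.
have mu0 : 0 <= mu := opnorm_ge0 p_ok _.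
have Mle : opnorm p (cplx_mx M) <= mu.
  apply: (opnorm_dominated p_ok) => i j.
  by rewrite !mxE normc_real ger0_norm// lerDl.
have MQle : opnorm p (cplx_mx M + Q) <= mu.
  apply: (opnorm_dominated p_ok) => i j; rewrite !mxE.
  by rewrite (le_trans (normcD _ _))// normc_real ger0_norm// lerD2l.
have Qle : opnorm p (cplx_mx M + Q - cplx_mx M) <= opnorm p (cplx_mx Rj).
  by rewrite addrC addKr; exact: opnorm_dominated.
rewrite -addrA; apply: le_lt_trans (Gamma_mx_perturbation p_ok MQle Mle Qle mul) _.
rewrite /delta -/mu ltr_pM2l; first exact: eint_ewt1_lt.
apply: (opnorm_gt0 p_ok); apply: contra Rn0 => /eqP/matrixP cR.
apply/eqP/matrixP => i j; have := cR i j; rewrite !mxE.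
by move=> /(congr1 (@complex.Re R)).
Qed.

Theorem theorem5p2 (R : realType) (p : exponent) (s : nat) (n : 'I_s -> nat)
    (lam : R[i])
    (Q : 'M[R[i]]_(\sum_(l < s) n l)) (Rj : 'M[R]_(\sum_(l < s) n l)) :
  let M : 'M[R]_(\sum_(l < s) n l) := \mxdiag_(l < s) superdiag R (n l) in
  valid_exponent p ->
  (forall l, (0 < n l)%N) ->
  (forall i k, 0 <= Rj i k) ->
  Rj != 0 ->
  0 < complex.Re lam - opnorm p (cplx_mx (M + Rj)) ->
  (forall i k, Normc.normc (Q i k) <= Rj i k) ->
  opnorm p (Gamma_mx (lam%:M + cplx_mx M + Q) - Gamma_mx (lam%:M + cplx_mx M))
    < delta p lam M Rj.
Proof.
move=> M p_ok _ R0 Rn0 mul QR.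
apply: Gamma_mx_perturbation_lt => // i k.
(* An entry of a block diagonal matrix is an entry of a diagonal block or 0. *)
rewrite mxE; case: ifP => _; last by rewrite mxE.
by rewrite /conform_mx; case: eqP => [?|_]; first case: eqP => [?|_];
  rewrite ?castmxE mxE.
Qed.
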